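(* Let $\|w\|_{L^\infty(\Omega)}\le\bar c_0<\bar v/\sqrt5$, $\|w_x\|_{L^\infty(\Omega)}\le\bar c_1$, $\|w_{xx}\|_{L^\infty(\Omega)}\le\bar c_2$, $\|w_{xxx}\|_{L^\infty(\Omega)}\le\bar c_3$, and $\tilde L:=\|x_D-x_O\|$. Let $\chi^*=(z^*,\lambda^* )$, $z^*=(L^*,\xi^* )$, be a globally optimal solution of problem (P) with its Lagrange multiplier $\lambda^*=0$, satisfying the first order necessary conditions and the second order sufficient conditions with constant $\underline{\mathcal B}>0$. Then there is $0<R<\min\{\underline{\mathcal B}/(2\bar\Gamma),\ \underline{\mathcal B}/40,\ \tilde L/2\}$ such that $$\mathcal L_{zz}(\chi)[\delta z]^2\ge\frac{\underline{\mathcal B}}{4}\|\delta z\|_{Z^2}^2$$ for any $\chi=(L,\xi,\lambda)\in\mathcal N_R(\chi^* )$ and any $\delta z=(\delta L,\delta\xi)\in\delta Z$ such that $\xi_\tau^T\delta\xi_\tau=L\,\delta L$ almost everywhere.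
   Context: Fix $\bar v>0$, $x_O\neq x_D\in\mathbb R^2$, and $w\in C^3(\mathbb R^2,\mathbb R^2)$ with $\|w(x)\|<\bar v$; $\Omega\subset\mathbb R^2$ is an ellipse with foci $x_O,x_D$ containing every globally optimal trajectory; $\|g\|_{L^\infty(D)}=\inf\{C\ge0:\|g(x)\|\le C\text{ a.e. on }D\}$ with Euclidean/operator norms. $f(x,p)=\frac{-p^Tw(x)+\sqrt{(p^Tw(x))^2+(\bar v^2-w(x)^Tw(x))p^Tp}}{\bar v^2-w(x)^Tw(x)}$; $X=\{\xi\in W^{1,\infty}(]0,1[,\mathbb R^2):\xi(0)=x_O,\xi(1)=x_D\}$, $\delta X=W^{1,\infty}_0(]0,1[,\mathbb R^2)$; $T(\xi)=\int_0^1f(\xi,\xi_\tau)d\tau$. Problem (P): minimize $T(\xi)$ over $\xi\in X,L\in\mathbb R$ s.t. $\|\xi_\tau\|^2=L^2$ a.e. $z=(L,\xi)\in Z=\mathbb R\times X$, $\delta Z=\mathbb R\times\delta X$, $h(z)=\xi_\tau^T\xi_\tau-L^2$. Norms: $\|z\|_{Z^\infty}=|L|+\|\xi\|_{L^\infty}+\|\xi_\tau\|_{L^\infty}$, $\|z\|_{Z^2}=|L|+\|\xi\|_{L^2}+\|\xi_\tau\|_{L^2}$, $\|(z,\lambda)\|_{Y^\infty}=\|z\|_{Z^\infty}+\|\lambda\|_{L^\infty}$; $\mathcal N_R(\chi^* )=\{\chi:\|\chi-\chi^*\|_{Y^\infty}\le R\}$. Lagrangian $\mathcal L(z,\lambda)=T(\xi)+\int_0^1\lambda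 h(z)d\tau$, so $\mathcal L_{zz}(\chi)[\delta z]^2=T''(\xi)[\delta\xi]^2+2\int_0^1\lambda(\delta\xi_\tau^T\delta\xi_\tau-\delta L^2)d\tau$. First order conditions: $\mathcal L'(z^*,\lambda^* )=0$. Second order sufficient conditions with $\underline{\mathcal B}$: there is $\kappa>0$ with $\inf_{0\ne\delta\lambda\in L^2}\sup_{\delta z\in\delta Z}\frac{\int_0^1\delta\lambda(2\xi_\tau^{*T}\delta\xi_\tau-2L^*\delta L)d\tau}{\|\delta\lambda\|_{L^2}\|\delta z\|_{Z^2}}\ge\kappa$, and $T''(\xi^* )[\delta\xi]^2\ge\underline{\mathcal B}\|\delta z\|^2_{Z^2}$ for all $\delta z\in\delta Z$ with $\delta\xi_\tau^T\xi^*_\tau=\delta L\,L^*$ a.e. The constant $\bar\Gamma=\bar\Gamma(R)$: with $\underline v^2=\bar v^2-\bar c_0^2$, $\bar\gamma_0=\frac{2}{\underline v^4}(37\bar c_1^3+21\bar c_1\bar c_2\underline v+2\bar c_3\underline v^2)$, $\bar\gamma_1=\frac{29\bar c_1^2+7\underline v\bar c_2}{\underline v^3}$, $\bar\gamma_2=\frac{57\bar c_1^2+13\underline v\bar c_2}{\underline v^3}$, $\bar\gamma_3=\frac{40\bar c_1}{\underline v^2}$, $\bar\gamma_4=\frac{20\bar c_1}{\underline v^2}$, $\bar\gamma_5=\frac{18}{\underline v}$, set $\bar\Gamma=\max\{(\frac{\bar v+\bar c_0}{\bar v-\bar c_0}\tilde L+R)\bar\gamma_0+\frac{\bar\gamma_2}2,\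 \frac{\bar\gamma_4}{\tilde L-R}+\frac{\bar\gamma_2}2,\ \bar\gamma_1+\frac{\bar\gamma_3}{2(\tilde L-R)},\ \frac{\bar\gamma_3}{2(\tilde L-R)}+\frac{\bar\gamma_5}{(\tilde L-R)^2}\}$. *)

(* Defs.v *)
From HB Require Import structures.
From mathcomp Require Import all_boot all_order all_algebra.
From mathcomp Require Import all_classical all_reals all_analysis.
Set Implicit Arguments. Unset Strict Implicit. Unset Printing Implicit Defensive.
Import Order.TTheory GRing.Theory Num.Theory numFieldNormedType.Exports.
Local Open Scope classical_set_scope.
Local Open Scope ring_scope.

Section Defs.
Variable R : realType.

Definition dot (p q : R * R) : R := p.1 * q.1 + p.2 * q.2.
Definition enorm (p : R * R) : R := Num.sqrt (dot p p).

Definition opnorm1 (A : R * R -> R * R) : R :=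
  sup [set enorm (A u) | u in [set u | enorm u <= 1]].
Definition opnorm2 (B : R * R -> R * R -> R * R) : R :=
  sup [set enorm (B uv.1 uv.2) | uv in [set uv : (R * R) * (R * R) |
          enorm uv.1 <= 1 /\ enorm uv.2 <= 1]].
Definition opnorm3 (C : R * R -> R * R -> R * R -> R * R) : R :=
  sup [set enorm (C uvt.1.1 uvt.1.2 uvt.2) | uvt in
        [set uvt : (R * R) * (R * R) * (R * R) |
          [/\ enorm uvt.1.1 <= 1, enorm uvt.1.2 <= 1 & enorm uvt.2 <= 1]]].

Definition D1 (w : R * R -> R * R) (x u : R * R) : R * R := 'D_u w x.
Definition D2 (w : R * R -> R * R) (x u v : R * R) : R * R :=
  'D_v (fun y => D1 w y u) x.
Definition D3 (w : R * R -> R * R) (x u v t : R * R) : R * R :=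
  'D_t (fun y => D2 w y u v) x.

Definition C3 (w : R * R -> R * R) : Prop :=
  continuous w /\
  forall u v t : R * R,
  (forall x, derivable w x u) /\
  continuous (fun y => D1 w y u) /\
  (forall x, derivable (fun y => D1 w y u) x v) /\
  continuous (fun y => D2 w y u v) /\
  (forall x, derivable (fun y => D2 w y u v) x t) /\
  continuous (fun y => D3 w y u v t).

Definition LinfOn d (T : measurableType d) (mu : {measure set T -> \bar R})
    (D : set T) (g : T -> R) : \bar R :=
  ereal_inf [set C%:E | C in [set C : R | 0 <= C /\
                            {ae mu, forall x, D x -> g x <= C}]].

Definition I01 : set R := `]0%R, 1%R[.
Definition leb := @lebesgue_measure R.

(* derivative in tau (defined a.e. for Lipschitz curves) *)
Definition dtau (xi : R -> R * R) : R -> R * R := fun t => derive1 xi t.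

(* W^{1,oo}(]0,1[, R^2), represented by its Lipschitz continuous representative
   on [0,1] *)
Definition W1inf (xi : R -> R * R) : Prop :=
  exists K : R, forall s t, s \in `[0%R, 1%R] -> t \in `[0%R, 1%R] ->
    enorm (xi s - xi t) <= K * `|s - t|.

Definition inX (xO xD : R * R) (xi : R -> R * R) : Prop :=
  [/\ W1inf xi, xi 0 = xO & xi 1 = xD].
Definition indX (dxi : R -> R * R) : Prop :=
  [/\ W1inf dxi, dxi 0 = 0 & dxi 1 = 0].

Definition Linf (g : R -> R) : \bar R := LinfOn leb I01 (fun t => `|g t|).
Definition LinfV (g : R -> R * R) : \bar R := LinfOn leb I01 (fun t => enorm (g t)).
Definition L2 (g : R -> R) : R := Num.sqrt (Rintegral leb I01 (fun t => g t ^+ 2)).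
Definition L2V (g : R -> R * R) : R :=
  Num.sqrt (Rintegral leb I01 (fun t => enorm (g t) ^+ 2)).

Definition inL2 (g : R -> R) : Prop :=
  measurable_fun I01 g /\ leb.-integrable I01 (fun t => (g t ^+ 2)%:E).
Definition inLinf (g : R -> R) : Prop :=
  measurable_fun I01 g /\ (Linf g < +oo)%E.

Definition Zinf (L : R) (xi : R -> R * R) : \bar R :=
  (`|L|%:E + LinfV xi + LinfV (dtau xi))%E.
Definition Z2 (L : R) (xi : R -> R * R) : R :=
  `|L| + L2V xi + L2V (dtau xi).
Definition Yinf (L : R) (xi : R -> R * R) (lam : R -> R) : \bar R :=
  (Zinf L xi + Linf lam)%E.

Definition fspeed (vbar : R) (w : R * R -> R * R) (x p : R * R) : R :=
  (- dot p (w x) + Num.sqrt ((dot p (w x)) ^+ 2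
        + (vbar ^+ 2 - dot (w x) (w x)) * dot p p))
  / (vbar ^+ 2 - dot (w x) (w x)).

Definition Ttime vbar w (xi : R -> R * R) : R :=
  Rintegral leb I01 (fun t => fspeed vbar w (xi t) (dtau xi t)).

Definition T2 vbar w (xi dxi : R -> R * R) : R :=
  derive1n 2 (fun s : R => Ttime vbar w (fun t => xi t + s *: dxi t)) 0.

Definition hcons (L : R) (xi : R -> R * R) : R -> R :=
  fun t => dot (dtau xi t) (dtau xi t) - L ^+ 2.

Definition Lag vbar w (L : R) (xi : R -> R * R) (lam : R -> R) : R :=
  Ttime vbar w xi + Rintegral leb I01 (fun t => lam t * hcons L xi t).

Definition Lzz vbar w (xi : R -> R * R) (lam : R -> R) (dL : R) (dxi : R -> R * R) : R :=
  T2 vbar w xi dxi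
  + 2 * Rintegral leb I01 (fun t => lam t * (dot (dtau dxi t) (dtau dxi t) - dL ^+ 2)).

Definition feasible (xO xD : R * R) (L : R) (xi : R -> R * R) : Prop :=
  inX xO xD xi /\ {ae leb, forall t, I01 t -> dot (dtau xi t) (dtau xi t) = L ^+ 2}.

Definition glob_opt vbar w xO xD (L : R) (xi : R -> R * R) : Prop :=
  feasible xO xD L xi /\
  forall L' xi', feasible xO xD L' xi' -> Ttime vbar w xi <= Ttime vbar w xi'.

Definition FOC (vbar : R) (w : R * R -> R * R) (L : R) (xi : R -> R * R) (lam : R -> R) : Prop :=
  forall (dL : R) (dxi : R -> R * R) (dlam : R -> R),
    indX dxi -> inLinf dlam ->
    is_derive (0 : R) (1 : R)
      (fun s : R => Lag vbar w (L + s * dL) (fun t => xi t + s *: dxi t)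
                       (fun t => lam t + s * dlam t)) 0.

Definition infsup_ratio (L : R) (xi : R -> R * R) (dl : R -> R) (dL : R)
    (dxi : R -> R * R) : R :=
  Rintegral leb I01 (fun t => dl t * (2 * dot (dtau xi t) (dtau dxi t) - 2 * L * dL))
  / (L2 dl * Z2 dL dxi).

Definition SOSC (vbar : R) (w : R * R -> R * R) (L : R) (xi : R -> R * R) (B : R) : Prop :=
  (exists2 kappa : R, 0 < kappa &
    (kappa%:E <=
      ereal_inf [set ereal_sup [set (infsup_ratio L xi dl p.1 p.2)%:E
                                 | p in [set p : R * (R -> R * R) | indX p.2]]
                | dl in [set dl : R -> R | inL2 dl /\
                           ~ {ae leb, forall t, I01 t -> dl t = 0%R}]])%E)
  /\
  forall (dL : R) (dxi : R -> R * R), indX dxi ->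
    {ae leb, forall t, I01 t -> dot (dtau dxi t) (dtau xi t) = dL * L} ->
    B * (Z2 dL dxi) ^+ 2 <= T2 vbar w xi dxi.

Definition Gamma_bar (vbar c0 c1 c2 c3 Lt Rr : R) : R :=
  let uv := Num.sqrt (vbar ^+ 2 - c0 ^+ 2) in
  let g0 := 2 / uv ^+ 4 * (37 * c1 ^+ 3 + 21 * c1 * c2 * uv + 2 * c3 * uv ^+ 2) in
  let g1 := (29 * c1 ^+ 2 + 7 * uv * c2) / uv ^+ 3 in
  let g2 := (57 * c1 ^+ 2 + 13 * uv * c2) / uv ^+ 3 in
  let g3 := 40 * c1 / uv ^+ 2 in
  let g4 := 20 * c1 / uv ^+ 2 in
  let g5 := 18 / uv in
  Num.max (Num.max (((vbar + c0) / (vbar - c0) * Lt + Rr) * g0 + g2 / 2)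
                   (g4 / (Lt - Rr) + g2 / 2))
          (Num.max (g1 + g3 / (2 * (Lt - Rr)))
                   (g3 / (2 * (Lt - Rr)) + g5 / (Lt - Rr) ^+ 2)).

End Defs.

Notation leb2 R := (@lebesgue_measure R \x @lebesgue_measure R)%E.

(* Main.v *)
(* The radius is existential, so only the behaviour as it tends to 0 matters. Along a line
   the integrand of T solves a quadratic equation, which gives its first two derivatives
   explicitly; they are continuous where the velocity does not vanish, so dominated
   convergence yields T''(xi)[dxi]^2 as the integral of a form F2 that is continuous and
   homogeneous of degree 2 in (dxi, dxi'). Since |xi*'| = |L*| > 0 almost everywhere,
   compactness makes F2 uniformly continuous near the optimal curve. An admissible direction
   dz at a nearby chi violates the linearised constraint at chi* only by O(R) |dz|; adding to
   dxi' a multiple of xi*' plus a constant multiple of its rotation by a right angle repairs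
   the constraint, and two constants suffice to keep the end points fixed because
   xO <> xD. The corrected direction differs from dz by O(R) |dz|, so coercivity at chi*
   is inherited with a smaller constant, and the multiplier contributes O(R) |dz|^2. *)
Require Import Defs.
From HB Require Import structures.
From mathcomp Require Import all_boot all_order all_algebra.
From mathcomp Require Import all_classical all_reals all_analysis.
From mathcomp Require Import measurable_realfun.
From mathcomp Require Import ring lra.
Import Order.TTheory GRing.Theory Num.Theory numFieldNormedType.Exports.
Local Open Scope classical_set_scope.
Local Open Scope ring_scope.
Set Implicit Arguments. Unset Strict Implicit. Unset Printing Implicit Defensive.

(** * Lipschitz functions of one variable *)

Section Rademacher.
Variable R : realType.
Notation mu := (@lebesgue_measure R).

(** Curves are only Lipschitz, they are constrained only on [0, 1], and [dtau] is a total derivative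
    with a default value where no derivative exists. Differentiability almost everywhere,
    measurability of [dtau] and the fundamental theorem of calculus therefore come before any
    computation with the integrals. Two norms compete in the perturbation argument: the base curves
    are close in the sup norm, while directions are measured in L2 and their derivatives have no
    pointwise bound in terms of that norm. A pointwise estimate can be integrated only if it is
    uniform in the base point and quadratic in the direction, which is what the homogeneity of [F2]
    provides. Coercivity at the optimum cannot be applied to the given direction, because the
    constraint linearised at the nearby curve has another kernel; hence the correction. The
    constants share the slack between B and B/4: the correction leaves 49/64 of B, the change of
    [F2] costs at most 16/64 and the multiplier at most 4/64, so that 29/64 remain where 16/64 are
    wanted. *)

Definition clamp01 (t : R) : R := Num.max 0 (Num.min 1 t).

Lemma clamp01_itv t : clamp01 t \in `[0, 1].
Proof. by rewrite in_itv/= /clamp01 le_max lexx/= ge_max ler01 ge_min lexx. Qed.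

Lemma clamp01_id t : t \in `[0, 1] -> clamp01 t = t.
Proof.
by rewrite in_itv/= => /andP[t0 t1]; rewrite /clamp01 min_r// max_r.
Qed.

Lemma clamp01B s t : s <= t -> 0 <= clamp01 t - clamp01 s <= t - s.
Proof.
move=> st; rewrite /clamp01 /Num.max /Num.min.
do ![case: ifPn => /=]; rewrite -?leNgt; lra.
Qed.

(** Both measures come from covers by half-open intervals: a cover of total length below [d] has
    total [G]-increment at most [M d]. *)
Lemma stieltjes_lipschitz_null (G : cumulative R R) (M : R) :
  (forall s t, s <= t -> G t - G s <= M * (t - s)) ->
  (lebesgue_stieltjes_measure G : {measure set _ -> \bar R}) `<< mu.
Proof.
move=> HG; apply/null_content_dominatesP => A mA A0.
have M0 : 0 <= M.
  have := HG 0 1 ler01; have := cumulative_is_nondecreasing G 0 1 ler01 => /=.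
  lra.
apply/eqP; rewrite eq_le measure_ge0 andbT.
apply/lee_addgt0Pr => e e0; rewrite add0e.
(* [M] may be 0, so [M + 1] is the divisor. *)
have d0 : 0 < e / (M + 1) by apply: divr_gt0 => //; lra.
pose S := [set (\sum_(0 <= k <oo) wlength (@idfun R) (C k))%E
           | C in @measurable_cover _ (ocitv_type R) A].
have {}A0 : ereal_inf S = 0%E by exact: A0.
have Sfin : ereal_inf S \is a fin_num by rewrite A0.
have [x [C [mC AC] Cx] xlt] := lb_ereal_inf_adherent d0 Sfin.
rewrite A0 add0e in xlt.
apply: (@le_trans _ _ (\sum_(0 <= k <oo) wlength G (C k))%E).
  by apply: ereal_inf_lbound; exists C.
apply: (@le_trans _ _ (\sum_(0 <= k <oo) (M%:E * wlength idfun (C k)))%E).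
  apply: lee_nneseries => [k _ _|k _]; first exact: wlength_ge0.
  have /ocitvP[->|[ab ablt ->]] := mC k; first by rewrite !wlength0 mule0.
  rewrite !wlength_itv/= lte_fin ablt -!EFinB -EFinM lee_fin; exact/HG/ltW.
rewrite nneseriesZl; last by move=> k _; exact: wlength_ge0.
rewrite Cx; apply: (@le_trans _ _ (M%:E * (e / (M + 1))%:E)%E).
  by apply: lee_wpmul2l; [rewrite lee_fin|exact: ltW].
rewrite -EFinM lee_fin mulrA ler_pdivrMr; last lra.
by rewrite mulrC ler_pM2l//; lra.
Qed.


(* [F + K id] is nondecreasing; its Stieltjes measure is absolutely continuous and its
   Radon-Nikodym density gives the derivative through Lebesgue differentiation. *)
Lemma lipschitz_ftc (F : R -> R) (K : R) :
  (forall s t, s \in `[0, 1] -> t \in `[0, 1] -> `|F s - F t| <= K * `|s - t|) ->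
  exists g : R -> R, [/\ mu.-integrable setT (EFin \o g),
    forall t, t \in `[0, 1] -> F t = F 0 + \int[mu]_(x in `]0, t]) g x &
    {ae mu, forall t, I01 t -> is_derive t 1 F (g t)}].
Proof.
move=> FK.
have K0 : 0 <= K.
  have := FK 0 1; rewrite !in_itv/= !lexx !ler01 => /(_ isT isT).
  by rewrite sub0r normrN normr1 mulr1; apply: le_trans.
(* Outside [0, 1] nothing is known about [F]; clamping the argument gives a function on the whole
   line, as a Stieltjes measure requires, without losing the Lipschitz bound. *)
pose H t := F (clamp01 t) + K * clamp01 t.
have HB s t : s <= t -> 0 <= H t - H s <= (K + K) * (t - s).
  move=> st; have /andP[c1 c2] := clamp01B st.
  have := FK (clamp01 t) (clamp01 s) (clamp01_itv t) (clamp01_itv s).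
  rewrite (ger0_norm c1) ler_norml => /andP[f1 f2].
  have := ler_wpM2l K0 c2; rewrite /H; lra.
have Hnd : nondecreasing H.
  by move=> s t /HB /andP[]; rewrite subr_ge0.
have Hrc : right_continuous H.
  apply/right_continuousW => x; apply/cvgrPdist_le => e e0.
  have d0 : 0 < e / (K + K + 1) by apply: divr_gt0 => //; lra.
  near=> t.
  have xt : `|x - t| <= e / (K + K + 1).
    by near: t; apply: cvgr_dist_le => //; exact: cvg_id.
  apply: (@le_trans _ _ ((K + K) * `|x - t|)).
    have [le|/ltW le] := leP x t.
      have /andP[h1 h2] := HB _ _ le.
      by rewrite distrC (distrC x) !ger0_norm// subr_ge0.
    have /andP[h1 h2] := HB _ _ le.
    by rewrite !ger0_norm// subr_ge0.
  apply: (@le_trans _ _ ((K + K) * (e / (K + K + 1)))).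
    by apply: ler_wpM2l => //; lra.
  rewrite mulrA ler_pdivrMr; last lra.
  by rewrite mulrC ler_pM2l//; lra.
pose G : cumulative R R := HB.pack H (isCumulative.Build R _ R H Hnd Hrc).
pose m : {measure set (measurableTypeR R) -> \bar R} := lebesgue_stieltjes_measure G.
have mE (a b : R) : a <= b -> m `]a, b]%classic = (H b - H a)%:E.
  move=> ab; transitivity (wlength G `]a, b]%classic); last first.
    by rewrite wlength_itv_bnd.
  by apply: (@measurable_mu_extE _ _ _ (wlength G)); exact: is_ocitv.
have m1 : (m `]0%R, 1%R]%classic < +oo)%E by rewrite mE ?ltry.
have mD : (measurable : set (set (measurableTypeR R))) `]0%R, 1%R]%classic.
  exact: measurable_itv.
(* Restricting to ]0, 1] makes the measure finite, as the Radon-Nikodym theorem asks. *)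
pose nu : {finite_measure set (measurableTypeR R) -> \bar R} := mfrestr mD m1.
have mnu : m `<< mu.
  by apply: (@stieltjes_lipschitz_null G (K + K)) => s t /HB /andP[].
have numu : nu `<< mu.
  apply/null_content_dominatesP => A mA A0.
  rewrite /nu /mfrestr /mrestr.
  move/null_content_dominatesP: mnu; apply; first exact: measurableI.
  apply/eqP; rewrite eq_le measure_ge0 andbT -A0; apply: le_measure; rewrite ?inE//.
  exact: measurableI.
have [g0 [g0ge g0fin g0int g0E]] := radon_nikodym_sigma_finite numu.
(* The subtracted term undoes the slope [K] that was added to make [H] nondecreasing. *)
pose g x := fine (g0 x) - K * \1_(`]0, 1]) x.
have int1 : mu.-integrable setT (EFin \o (fun x => fine (g0 x))).
  apply: eq_integrable g0int => // x _.
  by rewrite /= fineK.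
have int2 : mu.-integrable setT (EFin \o (fun x => K * (\1_(`]0, 1]) x))).
  rewrite (_ : EFin \o _ = (fun x => K%:E * (\1_(`]0, 1]) x)%:E)%E)//.
  apply: integrableZl => //; apply: integrable_indic_itv.
have gint : mu.-integrable setT (EFin \o g).
  rewrite (_ : EFin \o g = ((EFin \o (fun x => fine (g0 x))) \-
     (EFin \o (fun x => K * (\1_(`]0%R, 1%R]) x))%R))%E)//.
  exact: integrableB.
have gE t : t \in `[0, 1] -> F t = F 0 + \int[mu]_(x in `]0, t]) g x.
  move=> t01; have /andP[t0 t1] : 0 <= t <= 1 by move: t01; rewrite in_itv.
  have sub : `]0, t]%classic `<=` `]0, 1]%classic.
    by move=> x/=; rewrite !in_itv/= => /andP[-> /le_trans]; apply.
  rewrite RintegralB//; last 2 first.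
  - exact: integrableS int1.
  - exact: integrableS int2.
  have -> : \int[mu]_(x in `]0, t]) (fine (g0 x)) = H t - H 0.
    rewrite /Rintegral; under eq_integral do rewrite fineK//.
    rewrite -g0E//= /nu /mfrestr /mrestr (setIidl sub) mE//.
  have -> : \int[mu]_(x in `]0, t]) (K * (\1_(`]0, 1]) x)) = K * t.
    transitivity (\int[mu]_(x in `]0, t]) K).
      apply: eq_Rintegral => x; rewrite inE => /sub x01.
      by rewrite indicE mem_set// mulr1.
    have mut : mu `]0, t]%classic = t%:E.
      rewrite lebesgue_measure_itv/= lte_fin; case: ltP => h/=.
        by rewrite sube0.
      by have -> : t = 0 by lra.
    by rewrite Rintegral_cst//= mut.
  rewrite /H !clamp01_id//; last by rewrite in_itv/= lexx ler01.
  lra.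
exists g; split => //.
have locg : locally_integrable [set: R] g.
  by apply: open_integrable_locally => //; exact: openT.
have intg y : mu.-integrable [set` Interval (BRight 0) (BRight y)] (EFin \o g).
  exact: integrableS gint.
have := FTC1 intg locg.
apply: filterS; first exact: (ae_filter_ringOfSetsType mu).
move=> x + x01.
have /andP[x0 x1] : 0 < x < 1 by move: x01; rewrite /I01/= in_itv.
rewrite lte_fin => /(_ x0)[dP PE].
have isP : is_derive x 1 (fun y => F 0 + \int[mu]_(t in `]0, y]) g t) (g x).
  rewrite -[g x]add0r; apply: is_deriveD.
  by apply: DeriveDef => //; rewrite -derive1E.
apply: near_eq_is_derive isP => //.
near=> y.
apply/esym/gE; near: y.
have := @itv_open _ R 0 1; rewrite openE => /(_ x x01).
rewrite /interior/=; apply: filterS => y/=.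
by rewrite !in_itv/= => /andP[/ltW -> /ltW].
Unshelve. all: by end_near. Qed.

End Rademacher.

(** * Derivatives of plane curves and the set of differentiability *)

Section dtau.
Variable R : realType.
Notation mu := (@lebesgue_measure R).

Lemma is_derive_pair (xi : R -> R * R) (t : R) (a b : R) :
  is_derive t 1 (fun s => (xi s).1) a -> is_derive t 1 (fun s => (xi s).2) b ->
  is_derive t 1 xi (a, b).
Proof.
move=> [da <-] [db <-].
have H : (fun h : R => h^-1 *: ((xi \o shift t) (h *: 1) - xi t)) @ 0^' -->
    ('D_1 (fun s => (xi s).1) t, 'D_1 (fun s => (xi s).2) t).
  rewrite (_ : (fun h : R => _) = (fun h => 
    (h^-1 *: (((fun s => (xi s).1) \o shift t) (h *: 1) - (xi t).1),
     h^-1 *: (((fun s => (xi s).2) \o shift t) (h *: 1) - (xi t).2)))) //.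
  apply: (cvg_pair (G := nbhs _) (H := nbhs _)); [exact: da|exact: db].
apply: DeriveDef; first by apply/cvg_ex; eexists; exact: H.
exact/cvg_lim.
Qed.

Lemma derivable_fst (xi : R -> R * R) (t : R) : derivable xi t 1 ->
  is_derive t 1 (fun s => (xi s).1) ('D_1 xi t).1.
Proof.
move=> d.
have H : (fun h : R => h^-1 *: (((fun s => (xi s).1) \o shift t) (h *: 1) - (xi t).1)) @ 0^' -->
    ('D_1 xi t).1.
  have := @cvg_comp _ _ _ _ fst _ _ (nbhs ('D_1 xi t).1) d.
  apply; exact: cvg_fst.
apply: DeriveDef; first by apply/cvg_ex; eexists; exact: H.
exact/cvg_lim.
Qed.

Lemma derivable_snd (xi : R -> R * R) (t : R) : derivable xi t 1 ->
  is_derive t 1 (fun s => (xi s).2) ('D_1 xi t).2.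
Proof.
move=> d.
have H : (fun h : R => h^-1 *: (((fun s => (xi s).2) \o shift t) (h *: 1) - (xi t).2)) @ 0^' -->
    ('D_1 xi t).2.
  have := @cvg_comp _ _ _ _ snd _ _ (nbhs ('D_1 xi t).2) d.
  apply; exact: cvg_snd.
apply: DeriveDef; first by apply/cvg_ex; eexists; exact: H.
exact/cvg_lim.
Qed.

(* Differentiability is the Cauchy condition on difference quotients, a countable
   intersection of countable unions of closed sets. *)
Lemma measurable_derivable (F : R -> R) : continuous F ->
  measurable [set t | derivable F t 1].
Proof.
move=> cF.
pose Q h t : R := h^-1 *: (F (h *: 1 + t) - F t).
have cQ h : continuous (Q h).
  move=> t; rewrite /Q; apply: (@cvgM R); first exact: cvg_cst.
  apply: (@cvgB R); last exact: cF.
  apply: continuous_comp; last exact: cF.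
  by apply: (@cvgD R); [exact: cvg_cst|exact: cvg_id].
pose E k m := [set t | forall h h', h != 0 -> h' != 0 -> `|h| < m.+1%:R^-1 ->
  `|h'| < m.+1%:R^-1 -> `|Q h t - Q h' t| <= k.+1%:R^-1].
have cE k m : closed (E k m).
  (* The pairs of steps range over an uncountable set, which is harmless: each pair gives a closed
     condition on [t], and only [k] and [m] have to be countable. *)
  rewrite (_ : E k m = \bigcap_(p in [set p : R * R | [/\ p.1 != 0, p.2 != 0,
      `|p.1| < m.+1%:R^-1 & `|p.2| < m.+1%:R^-1]])
      ((fun t => `|Q p.1 t - Q p.2 t|) @^-1` [set x | x <= k.+1%:R^-1])); last first.
    apply/seteqP; split => t; first by move=> Et [h h']/= [*]; exact: Et.
    by move=> Et h h' h0 h'0 hm hm'; apply: (Et (h, h')).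
  apply: closed_bigI => p _; apply: closed_comp; last exact: closed_le.
  move=> t _; apply: cvg_norm; apply: cvgB; exact: cQ.
rewrite (_ : [set t | _] = \bigcap_k \bigcup_m E k m).
  apply: bigcapT_measurable => k; apply: bigcupT_measurable => m.
  exact: closed_measurable.
apply/seteqP; split => t.
- move=> dt k _.
  have /cauchy_cvgP/cauchy_ballP := dt.
  have k0 : 0 < k.+1%:R^-1 :> R by rewrite invr_gt0.
  move=> /(_ _ k0) [[A B]/= [A0 B0] AB].
  have [e/= e0 eA] := A0; have [e'/= e'0 eB] := B0.
  have [m hm] : exists m : nat, m.+1%:R^-1 < Num.min e e'.
    have ee : 0 < Num.min e e' by rewrite lt_min e0.
    exists (Num.bound (Num.min e e')^-1).
    rewrite invf_plt ?posrE//.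
    by apply: (lt_trans (archi_boundP _)); rewrite ?invr_ge0 ?(ltW ee)// ltr_nat.
  exists m => // h h' h0 h'0 hlt h'lt.
  have := AB (Q h t, Q h' t); rewrite /ball/= => H; apply/ltW/H; split => /=.
  + apply: eA => //=; rewrite sub0r normrN (lt_trans hlt)//.
    by move: hm; rewrite lt_min => /andP[].
  + apply: eB => //=; rewrite sub0r normrN (lt_trans h'lt)//.
    by move: hm; rewrite lt_min => /andP[].
- move=> Et; apply/cauchy_cvgP/cauchy_ballP => e e0.
  have [k hk] : exists k : nat, k.+1%:R^-1 < e.
    exists (Num.bound e^-1).
    rewrite invf_plt ?posrE//.
    by apply: (lt_trans (archi_boundP _)); rewrite ?invr_ge0 ?(ltW e0)// ltr_nat.
  have [m _ Em] := Et k I.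
  pose S := Q ^~ t @` [set h | h != 0 /\ `|h| < m.+1%:R^-1].
  have S0 : ((fun h => Q h t) @ 0^') S.
    exists m.+1%:R^-1 => /=; first by rewrite invr_gt0.
    by move=> h/=; rewrite sub0r normrN => hm h0; exists h.
  exists (S, S) => //= -[x y]/= [[h [h0 hm] <-] [h' [h'0 h'm] <-]].
  by rewrite /ball/=; apply: le_lt_trans hk; apply: Em.
Qed.

End dtau.

(** * The Euclidean plane *)

Section plane.
Variable R : realType.
Implicit Types p q : R * R.

Lemma dot_ge0 p : 0 <= dot p p.
Proof. by rewrite /dot -!expr2 addr_ge0 ?sqr_ge0. Qed.

Lemma enorm_ge0 p : 0 <= enorm p.
Proof. exact: sqrtr_ge0. Qed.

Lemma enorm_sqr p : enorm p ^+ 2 = dot p p.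
Proof. by rewrite sqr_sqrtr// dot_ge0. Qed.

Lemma enorm_le p (c : R) : 0 <= c -> dot p p <= c ^+ 2 -> enorm p <= c.
Proof. by move=> c0 h; rewrite -[c]ger0_norm// -sqrtr_sqr; exact: ler_wsqrtr. Qed.

Lemma enorm_fst p : `|p.1| <= enorm p.
Proof.
rewrite -sqrtr_sqr /enorm; apply: ler_wsqrtr.
by rewrite /dot -!expr2 lerDl sqr_ge0.
Qed.

Lemma enorm_snd p : `|p.2| <= enorm p.
Proof.
rewrite -sqrtr_sqr /enorm; apply: ler_wsqrtr.
by rewrite /dot -!expr2 lerDr sqr_ge0.
Qed.

Lemma enorm_le_sum p : enorm p <= `|p.1| + `|p.2|.
Proof.
apply: enorm_le; first exact: addr_ge0.
rewrite sqrrD !real_normK ?num_real// /dot -!expr2.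
have := mulr_ge0 (normr_ge0 p.1) (normr_ge0 p.2).
by rewrite -mulr_natl; lra.
Qed.

(** Lagrange's identity: the defect is the squared determinant of [p] and [q]. *)
Lemma dot_sqr_le p q : dot p q ^+ 2 <= dot p p * dot q q.
Proof.
rewrite /dot -subr_ge0.
rewrite (_ : _ - _ = (p.1 * q.2 - p.2 * q.1) ^+ 2) ?sqr_ge0//; ring.
Qed.

Lemma dot_le p q : `|dot p q| <= enorm p * enorm q.
Proof.
rewrite /enorm -sqrtrM ?dot_ge0// -sqrtr_sqr; exact/ler_wsqrtr/dot_sqr_le.
Qed.

Lemma enormD p q : enorm (p + q) <= enorm p + enorm q.
Proof.
apply: enorm_le; first by rewrite addr_ge0// enorm_ge0.
rewrite sqrrD !enorm_sqr.
have := le_trans (ler_norm _) (dot_le p q).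
rewrite /dot/= -mulr_natl; lra.
Qed.

End plane.

(** * Lipschitz curves and measurability of their derivatives *)

Section curves.
Variable R : realType.
Notation mu := (@lebesgue_measure R).

Lemma aeS (P Q : R -> Prop) : (forall t, P t -> Q t) ->
  {ae mu, forall t, P t} -> {ae mu, forall t, Q t}.
Proof. by move=> PQ; apply: filterS; first exact: (ae_filter_ringOfSetsType mu). Qed.

Lemma aeI (P Q : R -> Prop) : {ae mu, forall t, P t} -> {ae mu, forall t, Q t} ->
  {ae mu, forall t, P t /\ Q t}.
Proof. by move=> p q; apply: filterI; first exact: (ae_filter_ringOfSetsType mu). Qed.

Definition lip01 (F : R -> R) (K : R) := forall s t,
  s \in `[0, 1] -> t \in `[0, 1] -> `|F s - F t| <= K * `|s - t|.

Lemma W1inf_lip (xi : R -> R * R) : W1inf xi ->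
  exists K, lip01 (fun t => (xi t).1) K /\ lip01 (fun t => (xi t).2) K.
Proof.
move=> [K HK]; exists K; split => s t s0 t0; apply: le_trans (HK s t s0 t0).
  exact: (enorm_fst (xi s - xi t)).
exact: (enorm_snd (xi s - xi t)).
Qed.

Lemma lip_W1inf (F G : R -> R) (K K' : R) : lip01 F K -> lip01 G K' ->
  W1inf (fun t => (F t, G t)).
Proof.
move=> HF HG; exists (K + K') => s t s0 t0.
apply: le_trans (enorm_le_sum _) _; rewrite mulrDl.
by apply: lerD; [exact: HF|exact: HG].
Qed.

Lemma lip01_ge0 F K : lip01 F K -> 0 <= K.
Proof.
move=> /(_ 0 1); rewrite !in_itv/= !lexx !ler01 => /(_ isT isT).
by rewrite sub0r normrN normr1 mulr1; apply: le_trans.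
Qed.

Lemma lip01_clamp_continuous F K : lip01 F K -> continuous (F \o @clamp01 R).
Proof.
move=> FK x; have K0 := lip01_ge0 FK.
apply/cvgrPdist_le => e e0.
have d0 : 0 < e / (K + 1) by apply: divr_gt0 => //; lra.
near=> t.
have xt : `|x - t| <= e / (K + 1).
  by near: t; apply: cvgr_dist_le => //; exact: cvg_id.
have cle : `|clamp01 x - clamp01 t| <= `|x - t|.
  have [le|/ltW le] := leP x t; have /andP[h1 h2] := clamp01B le.
    by rewrite distrC (distrC x) !ger0_norm// subr_ge0.
  by rewrite !ger0_norm// subr_ge0.
apply: le_trans (FK _ _ (clamp01_itv x) (clamp01_itv t)) _.
apply: (@le_trans _ _ (K * (e / (K + 1)))).
  by apply: ler_wpM2l => //; exact: le_trans xt.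
rewrite mulrA ler_pdivrMr; last lra.
by rewrite mulrC ler_pM2l//; lra.
Unshelve. all: by end_near. Qed.

Lemma near_clamp01 (T : Type) (xi : R -> T) (t : R) : I01 t ->
  \near t, xi (clamp01 t) = xi t.
Proof.
move=> t01.
have := @itv_open _ R 0 1; rewrite openE => /(_ t t01).
rewrite /interior/=; apply: filterS => y/=.
by rewrite in_itv/= => /andP[y0 y1]; rewrite clamp01_id// in_itv/= !ltW.
Qed.

Lemma I01_sub01 (t : R) : I01 t -> t \in `[0, 1].
Proof. by rewrite /I01/= !in_itv/= => /andP[/ltW -> /ltW]. Qed.

Lemma lip01_continuous F K (t : R) : lip01 F K -> I01 t -> {for t, continuous F}.
Proof.
move=> /lip01_clamp_continuous/(_ t) cF t01.
rewrite /prop_for /continuous_at.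
have h := near_clamp01 F t01.
have -> : F t = (F \o @clamp01 R) t by rewrite /= clamp01_id// I01_sub01.
apply: cvg_trans cF; apply: near_eq_cvg.
by near=> s; rewrite /=; near: s.
Unshelve. all: by end_near. Qed.

Lemma derive_lip_le F K (t d : R) : lip01 F K -> I01 t -> is_derive t 1 F d ->
  `|d| <= K.
Proof.
move=> FK t01 [dF <-].
have cn : `|h^-1 *: ((F \o shift t) (h *: 1) - F t)| @[h --> 0^'] --> `|'D_1 F t|.
  exact: cvg_norm.
apply: (cvgr_to_le cn).
have /open_nbhs_nbhs : open_nbhs t (@I01 R) by split => //; exact: itv_open.
case=> e /= e0 et.
exists e => // h /=; rewrite sub0r normrN => he h0.
have hI : I01 (h *: 1 + t).
  by apply: et => /=; rewrite scaler1 opprD addrCA subrr addr0 normrN.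
rewrite normrM normfV ler_pdivrMl ?normr_gt0//.
have := FK _ _ (I01_sub01 hI) (I01_sub01 t01).
by rewrite addrK mulrC [h *: 1]mulr1.
Qed.

Lemma ae_derivable_W1inf (xi : R -> R * R) : W1inf xi ->
  {ae mu, forall t, I01 t -> derivable xi t 1}.
Proof.
move=> /W1inf_lip[K [/lipschitz_ftc[g1 [_ _ h1]] /lipschitz_ftc[g2 [_ _ h2]]]].
apply: aeS (aeI h1 h2) => t [{}h1 {}h2] It.
by have [] := is_derive_pair (h1 It) (h2 It).
Qed.

Lemma dtau_derivable (xi : R -> R * R) t : derivable xi t 1 ->
  [/\ is_derive t 1 xi (dtau xi t), is_derive t 1 (fun s => (xi s).1) (dtau xi t).1
   & is_derive t 1 (fun s => (xi s).2) (dtau xi t).2].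
Proof.
move=> d; rewrite /dtau derive1E; split; first exact: DeriveDef.
  exact: derivable_fst.
exact: derivable_snd.
Qed.

Lemma dtau_bounded (xi : R -> R * R) : W1inf xi ->
  exists K, forall t, I01 t -> enorm (dtau xi t) <= K.
Proof.
move=> /W1inf_lip[K [l1 l2]].
have K0 := lip01_ge0 l1.
(* The last summand covers the points where [xi] has no derivative and [dtau xi] takes the default
   value [point]. *)
exists (K + K + enorm (point : R * R)) => t It.
have [dt|dt] := pselect (derivable xi t 1).
  have [_ d1 d2] := dtau_derivable dt.
  apply: le_trans (enorm_le_sum _) _.
  have := derive_lip_le l1 It d1; have := derive_lip_le l2 It d2.
  have := enorm_ge0 (point : R * R); lra.
rewrite /dtau derive1E /derive dvgP//; lra.
Qed.

(** On the measurable set of differentiability the function is a limit of difference quotients with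
    steps 1/(n+1); off that set [dtau] is constant. The map [f] stands for the two projections. *)
Lemma measurable_dtau_aux (f : R * R -> R) (xi : R -> R * R) :
  continuous f -> W1inf xi ->
  measurable_fun (@I01 R) (fun t => f (dtau xi t)).
Proof.
move=> cf W; have [K [l1 l2]] := W1inf_lip W.
(* The clamped curve is continuous on the whole line, so its quotients are continuous even where [t]
   plus the step leaves [0, 1], and it has the derivative of [xi] inside [I01]. *)
pose X := xi \o @clamp01 R.
have c1 := lip01_clamp_continuous l1; have c2 := lip01_clamp_continuous l2.
have cX : continuous X.
  move=> t; rewrite (_ : X = (fun t => ((X t).1, (X t).2))); last first.
    by apply/funext => s; rewrite -surjective_pairing.
  by apply: (cvg_pair (G := nbhs _) (H := nbhs _)); [exact: c1|exact: c2].
pose D := [set t | derivable (fun s => (X s).1) t 1] `&`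
          [set t | derivable (fun s => (X s).2) t 1].
have mD : measurable D by apply: measurableI; exact: measurable_derivable.
have DE t : D t <-> derivable X t 1.
  split=> [[d1 d2]|/dtau_derivable[_ [d1 _] [d2 _]]//].
  by have [] := is_derive_pair (DeriveDef d1 erefl) (DeriveDef d2 erefl).
have mI : measurable (@I01 R) by exact: measurable_itv.
have dE t : I01 t -> dtau xi t = dtau X t.
  move=> It; rewrite /dtau !derive1E; apply/esym/near_eq_derive.
  exact: (near_clamp01 xi It).
apply: (@eq_measurable_fun _ _ _ _ _ (fun t => f (dtau X t))).
  by move=> t; rewrite inE => It; rewrite dE.
rewrite (_ : @I01 R = (@I01 R `&` D) `|` (@I01 R `&` ~` D)); last first.
  by rewrite -setIUr setUv setIT.
apply/measurable_funU; [exact: measurableI|by apply: measurableI => //; exact: measurableC|].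
split; last first.
  apply: (@eq_measurable_fun _ _ _ _ _ (cst (f point))); last exact: measurable_cst.
  move=> t; rewrite inE => -[It nD].
  rewrite /dtau derive1E /derive dvgP// => d; apply: nD; exact/DE.
pose Q (n : nat) t := f (n.+1%:R *: (X (n.+1%:R^-1 + t) - X t)).
apply: (@measurable_fun_cvg _ _ _ _ Q).
  move=> n; apply: measurable_funTS; apply: continuous_measurable_fun => t.
  rewrite /Q; apply: continuous_comp; last exact: cf.
  apply: cvgZr; apply: cvgB; last exact: cX.
  apply: continuous_comp; last exact: cX.
  by apply: (@cvgD R); [exact: cvg_cst|exact: cvg_id].
move=> t [_ /DE dt].
have /cvgr_dnbhsP : f (h^-1 *: (X (h + t) - X t)) @[h --> 0^'] --> f (dtau X t).
  apply: continuous_cvg; first exact: cf.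
  rewrite /dtau derive1E.
  by move: dt; rewrite /derivable /derive; under eq_fun do rewrite /= [_ *: 1]mulr1.
move=> /(_ (fun n => n.+1%:R^-1)).
rewrite (_ : Q ^~ t = (fun n => f ((n.+1%:R^-1)^-1 *: (X (n.+1%:R^-1 + t) - X t)))).
  apply; split; last exact: cvg_harmonic.
  by move=> n; rewrite invr_neq0// pnatr_eq0.
by apply/funext => n; rewrite /Q invrK.
Qed.

Lemma measurable_dtau1 (xi : R -> R * R) : W1inf xi ->
  measurable_fun (@I01 R) (fun t => (dtau xi t).1).
Proof. by move=> W; apply: (measurable_dtau_aux (f := fst)) => // p; exact: cvg_fst. Qed.

Lemma measurable_dtau2 (xi : R -> R * R) : W1inf xi ->
  measurable_fun (@I01 R) (fun t => (dtau xi t).2).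
Proof. by move=> W; apply: (measurable_dtau_aux (f := snd)) => // p; exact: cvg_snd. Qed.

End curves.

(** * Bounded measurable functions on the unit interval *)

Section bounded_integrals.
Variable R : realType.
Notation mu := (@lebesgue_measure R).
Notation RI g := (Rintegral (@leb R) (@I01 R) g).

(** The bound holds at every point and not only almost everywhere. Such functions form an algebra
    and are all integrable on [I01], so integrability reduces to closure properties. *)
Definition bdm (g : R -> R) := measurable_fun (@I01 R) g /\
  exists K, forall t, I01 t -> `|g t| <= K.

Lemma measurable_I01 : measurable (@I01 R).
Proof. exact: measurable_itv. Qed.

Lemma leb_I01 : @leb R (@I01 R) = 1%:E.
Proof. by rewrite /leb /I01 lebesgue_measure_itv/= lte_fin ltr01 sube0. Qed.

Lemma bdm_cst c : bdm (fun=> c).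
Proof. by split; [exact: measurable_cst|exists `|c|]. Qed.

Lemma bdmD f g : bdm f -> bdm g -> bdm (fun t => f t + g t).
Proof.
move=> [mf [K HK]] [mg [K' HK']]; split; first exact: measurable_funD.
by exists (K + K') => t It; rewrite (le_trans (ler_normD _ _))// lerD ?HK ?HK'.
Qed.

Lemma bdmM f g : bdm f -> bdm g -> bdm (fun t => f t * g t).
Proof.
move=> [mf [K HK]] [mg [K' HK']]; split; first exact: measurable_funM.
by exists (K * K') => t It; rewrite normrM ler_pM ?HK ?HK'.
Qed.

Lemma bdmZ c f : bdm f -> bdm (fun t => c * f t).
Proof. by move=> bf; apply: bdmM => //; exact: bdm_cst. Qed.

Lemma bdmN f : bdm f -> bdm (fun t => - f t).
Proof.
move=> [mf [K HK]]; split; first by apply: measurableT_comp mf.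
by exists K => t It; rewrite normrN HK.
Qed.

Lemma bdmB f g : bdm f -> bdm g -> bdm (fun t => f t - g t).
Proof. by move=> bf bg; apply: bdmD => //; exact: bdmN. Qed.

Lemma bdm_sqr f : bdm f -> bdm (fun t => f t ^+ 2).
Proof. by move=> bf; under eq_fun do rewrite expr2; exact: bdmM. Qed.


Lemma bdm_integrable g : bdm g -> (@leb R).-integrable (@I01 R) (EFin \o g).
Proof.
move=> [mg [K HK]].
apply: measurable_bounded_integrable => //.
- exact: measurable_I01.
- by change (@leb R (@I01 R) < +oo)%E; rewrite leb_I01 ltry.
- exists K; split; first exact: num_real.
  by move=> x Kx t It /=; apply: le_trans (HK t It) (ltW Kx).
Qed.

Lemma RI_cst c : RI (fun=> c) = c.
Proof.
rewrite /leb Rintegral_cst; last exact: measurable_I01.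
by change (c * fine (@leb R (@I01 R)) = c); rewrite leb_I01 mulr1.
Qed.

Lemma RID f g : bdm f -> bdm g -> RI (fun t => f t + g t) = RI f + RI g.
Proof.
by move=> bf bg; apply: RintegralD; [exact: measurable_I01|exact: bdm_integrable..].
Qed.

Lemma RIB f g : bdm f -> bdm g -> RI (fun t => f t - g t) = RI f - RI g.
Proof.
by move=> bf bg; apply: RintegralB; [exact: measurable_I01|exact: bdm_integrable..].
Qed.

Lemma RIZ c f : bdm f -> RI (fun t => c * f t) = c * RI f.
Proof.
by move=> bf; apply: RintegralZl; [exact: measurable_I01|exact: bdm_integrable].
Qed.

Lemma eq_RI f g : (forall t, I01 t -> f t = g t) -> RI f = RI g.
Proof. by move=> fg; apply: eq_Rintegral => t; rewrite inE => /fg. Qed.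

(** Turns hypotheses that hold almost everywhere into pointwise ones on a smaller domain. *)
Lemma RI_ae f (N : set R) : bdm f -> measurable N -> mu N = 0 ->
  RI f = Rintegral (@leb R) (@I01 R `\` N) f.
Proof.
move=> bf mN N0; rewrite /Rintegral; congr fine.
by apply: negligible_integral => //; [exact: measurable_I01|exact: bdm_integrable].
Qed.

Lemma ae_null (P : R -> Prop) : {ae mu, forall t, I01 t -> P t} ->
  exists N : set R, [/\ measurable N, mu N = 0 & forall t, (@I01 R `\` N) t -> P t].
Proof.
move=> [N [mN N0 PN]]; exists N; split; [exact: mN|exact: N0|] => t [It nNt].
by have [//|nP] := pselect (P t); exfalso; apply: nNt; apply: PN => /= /(_ It).
Qed.

Lemma ae_le_RI f g : bdm f -> bdm g -> {ae mu, forall t, I01 t -> f t <= g t} ->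
  RI f <= RI g.
Proof.
move=> bf bg /ae_null[N [mN N0 fg]].
have mD : measurable (@I01 R `\` N) by apply: measurableD => //; exact: measurable_I01.
rewrite (RI_ae bf mN N0) (RI_ae bg mN N0); apply: le_Rintegral => //.
- by apply: integrableS (bdm_integrable bf) => //; exact: measurable_I01.
- by apply: integrableS (bdm_integrable bg) => //; exact: measurable_I01.
Qed.

Lemma ae_eq_RI f g : bdm f -> bdm g -> {ae mu, forall t, I01 t -> f t = g t} ->
  RI f = RI g.
Proof.
move=> bf bg fg; apply/eqP; rewrite eq_le; apply/andP; split; apply: ae_le_RI => //.
  by apply: aeS fg => t h It; rewrite h.
by apply: aeS fg => t h It; rewrite h.
Qed.

Lemma RI_ge0 f : (forall t, I01 t -> 0 <= f t) -> 0 <= RI f.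
Proof. by move=> f0; apply: Rintegral_ge0 => t; exact: f0. Qed.

(** The variance of [f] is nonnegative, and [I01] has measure 1. *)
Lemma RI_sqr_le f : bdm f -> RI f ^+ 2 <= RI (fun t => f t ^+ 2).
Proof.
move=> bf; set m := RI f.
have h : 0 <= RI (fun t => (f t - m) ^+ 2) by apply: RI_ge0 => t _; exact: sqr_ge0.
have := bdm_sqr bf => bf2.
have bm : bdm (fun t => 2 * m * f t) by exact: bdmZ.
have e : RI (fun t => (f t - m) ^+ 2) = RI (fun t => f t ^+ 2) - 2 * m * m + m ^+ 2.
  rewrite (@eq_RI _ (fun t => (f t ^+ 2 - 2 * m * f t) + m ^+ 2)); last by move=> t _; ring.
  rewrite RID; [|exact: bdmB|exact: bdm_cst].
  by rewrite RIB// RIZ// RI_cst.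
by move: h; rewrite e; lra.
Qed.


Lemma bdm_lip F K : lip01 F K -> bdm F.
Proof.
move=> FK; split.
  apply: open_continuous_measurable_fun; first exact: itv_open.
  by move=> t; rewrite inE => It; exact: (lip01_continuous FK).
exists (`|F 0| + K) => t It.
have z : (0 : R) \in `[0, 1] by rewrite in_itv/= lexx ler01.
have := FK _ _ (I01_sub01 It) z.
have : t <= 1 by move: It; rewrite /I01/= in_itv/= => /andP[_ /ltW].
have : 0 <= t by move: It; rewrite /I01/= in_itv/= => /andP[/ltW].
have K0 := lip01_ge0 FK.
move=> t0 t1; rewrite subr0 (ger0_norm t0) => h.
have := ler_normD (F t - F 0) (F 0); rewrite subrK.
have := ler_wpM2l K0 t1; lra.
Qed.

Lemma bdm_W1inf (xi : R -> R * R) : W1inf xi ->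
  bdm (fun t => (xi t).1) /\ bdm (fun t => (xi t).2).
Proof. by move=> /W1inf_lip[K [l1 l2]]; split; apply: bdm_lip; eassumption. Qed.

Lemma bdm_dtau (xi : R -> R * R) : W1inf xi ->
  bdm (fun t => (dtau xi t).1) /\ bdm (fun t => (dtau xi t).2).
Proof.
move=> W; have [K HK] := dtau_bounded W; split; split.
- exact: measurable_dtau1.
- by exists K => t It; apply: le_trans (HK t It); exact: enorm_fst.
- exact: measurable_dtau2.
- by exists K => t It; apply: le_trans (HK t It); exact: enorm_snd.
Qed.

Lemma bdm_dot (p q : R -> R * R) :
  bdm (fun t => (p t).1) -> bdm (fun t => (p t).2) ->
  bdm (fun t => (q t).1) -> bdm (fun t => (q t).2) -> bdm (fun t => dot (p t) (q t)).
Proof. by move=> *; apply: bdmD; exact: bdmM. Qed.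

End bounded_integrals.

(** * The fundamental theorem of calculus and a Poincaré inequality *)

Section primitives.
Variable R : realType.
Notation mu := (@lebesgue_measure R).
Notation RI g := (Rintegral (@leb R) (@I01 R) g).

Lemma bdm_indic_itv d (t : R) : bdm d -> bdm (fun s => d s * \1_(`]0, t]) s).
Proof.
move=> bd; apply: bdmM => //; split.
  by apply: measurable_funTS; apply: measurable_indic.
exists 1 => s _; rewrite indicE; case: (_ \in _); rewrite ?normr0 ?normr1//.
Qed.

(** The density given by [lipschitz_ftc] agrees with [d] almost everywhere by uniqueness of the
    derivative. Truncating by an indicator keeps every integral over [I01], where the rules for
    [bdm] apply. *)
Lemma lip01_ftc F K d t : lip01 F K -> bdm d ->
  {ae mu, forall t, I01 t -> is_derive t 1 F (d t)} -> t \in `[0, 1] ->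
  F t = F 0 + RI (fun s => d s * \1_(`]0, t]) s).
Proof.
move=> FK bd Fd t01; have [g [gint gE gd]] := lipschitz_ftc FK.
have /andP[t0 t1] : 0 <= t <= 1 by move: t01; rewrite in_itv.
rewrite gE//; congr (_ + _).
have sub : `]0, t]%classic `<=` `]0, 1]%classic.
  by move=> x/=; rewrite !in_itv/= => /andP[-> /le_trans]; apply.
have intr : mu.-integrable setT (EFin \o (g \_ `]0, t])).
  rewrite -restrict_EFin; apply: (integrable_mkcond _ _).1; first exact: measurable_itv.
  by apply: integrableS gint => //; exact: measurable_itv.
transitivity (Rintegral (@leb R) (@I01 R) (g \_ `]0, t])).
  rewrite -[in LHS](setIidr sub) Rintegral_mkcondr/= -Rintegral_itv_bndo_bndc//.
  exact: integrableS intr.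
rewrite /Rintegral; congr fine; apply: ae_eq_integral.
- exact: measurable_I01.
- have /integrableP[mr _] := intr; exact: measurable_funTS mr.
- by apply/measurable_EFinP; have [] := bdm_indic_itv t bd.
- apply: aeS (aeI Fd gd) => s [{}Fd {}gd] Is.
  have -> : d s = g s.
    by have [_ <-] := Fd Is; have [_ <-] := gd Is.
  by rewrite patchE indicE; case: ifPn => _; rewrite ?mulr1 ?mulr0.
Qed.

Lemma lip01_ftc1 F K d : lip01 F K -> bdm d ->
  {ae mu, forall t, I01 t -> is_derive t 1 F (d t)} -> F 1 - F 0 = RI d.
Proof.
move=> FK bd Fd; have o : (1 : R) \in `[0, 1] by rewrite in_itv/= lexx ler01.
rewrite (lip01_ftc FK bd Fd o) addrC addKr; apply: eq_RI => s.
rewrite /I01/= => s01; rewrite indicE mem_set ?mulr1//=.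
by move: s01; rewrite !in_itv/= => /andP[-> /ltW].
Qed.

(** Jensen's inequality for the truncated density, whose square is at most that of [d]. *)
Lemma lip01_poincare F K d t : lip01 F K -> bdm d ->
  {ae mu, forall t, I01 t -> is_derive t 1 F (d t)} -> t \in `[0, 1] ->
  (F t - F 0) ^+ 2 <= RI (fun s => d s ^+ 2).
Proof.
move=> FK bd Fd t01; rewrite (lip01_ftc FK bd Fd t01) addrC addKr.
have bi := bdm_indic_itv t bd.
apply: (le_trans (RI_sqr_le bi)).
apply: ae_le_RI; [exact: bdm_sqr|exact: bdm_sqr|].
apply: aeW => s _; rewrite indicE; case: (_ \in _); rewrite ?mulr1//.
by rewrite mulr0 expr0n/= sqr_ge0.
Qed.

(** Serves to build a curve from a prescribed bounded derivative, namely the corrector of the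
    constraint. *)
Lemma primitive_lip01 g : bdm g -> exists F K,
  [/\ lip01 F K, F 0 = 0, F 1 = RI g & {ae mu, forall t, I01 t -> is_derive t 1 F (g t)}].
Proof.
move=> bg; pose G := g \_ (@I01 R).
have Gint : mu.-integrable setT (EFin \o G).
  rewrite /G -restrict_EFin; apply: (integrable_mkcond _ _).1; first exact: measurable_I01.
  exact: bdm_integrable.
have intG A : measurable A -> mu.-integrable A (EFin \o G).
  by move=> mA; exact: integrableS Gint.
have [_ [K HK]] := bg.
(* [G] vanishes outside [I01], so a bound on the whole line has to be nonnegative. *)
have GK s : `|G s| <= Num.max 0 K.
  rewrite /G patchE; case: ifPn => [|_]; last by rewrite normr0 le_max lexx.
  by rewrite inE => /HK h; rewrite le_max h orbT.
pose F y := \int[mu]_(x in [set` Interval (BRight 0) (BRight y)]) G x.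
have FB s t : 0 <= s -> s <= t -> `|F t - F s| <= Num.max 0 K * (t - s).
  move=> s0 st; rewrite /F (@Rintegral_itvB _ G (BRight 0) (BRight t) s)//; last exact: intG.
  apply: le_trans (le_normr_Rintegral _ _) _ => //; first exact: intG.
  have muE : mu `]s, t]%classic = (t - s)%:E.
    rewrite lebesgue_measure_itv/= lte_fin; case: ltP => h/=; first by rewrite EFinB.
    have -> : t = s by apply: le_anti; rewrite h st.
    by rewrite subrr.
  have <- : \int[mu]_(x in `]s, t]) (Num.max 0 K) = Num.max 0 K * (t - s).
    by rewrite Rintegral_cst//= [X in fine X]muE.
  apply: le_Rintegral => //.
  - have /integrableP[mG iG] := intG `]s, t]%classic (measurable_itv _).
    apply/integrableP; split.
      by apply/measurable_EFinP/measurableT_comp => //; exact/measurable_EFinP.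
    by under eq_integral do rewrite /= normr_id.
  - apply: measurable_bounded_integrable => //; first by rewrite [X in (X < _)%E]muE ltry.
    exists (Num.max 0 K); split; first exact: num_real.
    by move=> x /ltW h y _ /=; rewrite ger0_norm// le_max lexx.
exists F, (Num.max 0 K); split.
- move=> s t; rewrite !in_itv/= => /andP[s0 _] /andP[t0 _].
  have [le|/ltW le] := leP s t.
    by rewrite distrC (distrC s) (ger0_norm (_ : 0 <= t - s)) ?subr_ge0// FB.
  by rewrite (ger0_norm (_ : 0 <= s - t)) ?subr_ge0// FB.
- by rewrite /F set_itv_ge ?Rintegral_set0// bnd_simp ltxx.
- rewrite /F -Rintegral_itv_bndo_bndc; last exact: intG.
  by apply: eq_Rintegral => x x01; rewrite /G patchE x01.
- have locG : locally_integrable [set: R] G.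
    by apply: open_integrable_locally => //; exact: openT.
  have iG y : mu.-integrable [set` Interval (BRight 0) (BRight y)] (EFin \o G).
    exact: intG.
  apply: aeS (FTC1 iG locG) => x + x01.
  have /andP[x0 x1] : 0 < x < 1 by move: x01; rewrite /I01/= in_itv.
  rewrite lte_fin => /(_ x0)[dP PE].
  apply: DeriveDef => //; rewrite -derive1E PE /G patchE ifT//.
  by rewrite inE.
Qed.

Lemma W1inf_dtau_ae (xi : R -> R * R) : W1inf xi ->
  {ae mu, forall t, I01 t -> is_derive t 1 (fun s => (xi s).1) (dtau xi t).1} /\
  {ae mu, forall t, I01 t -> is_derive t 1 (fun s => (xi s).2) (dtau xi t).2}.
Proof.
move=> /ae_derivable_W1inf h.
by split; apply: aeS h => t + It => /(_ It)/dtau_derivable[].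
Qed.

Lemma RI_dtau (xi : R -> R * R) : W1inf xi ->
  RI (fun t => (dtau xi t).1) = (xi 1).1 - (xi 0).1 /\
  RI (fun t => (dtau xi t).2) = (xi 1).2 - (xi 0).2.
Proof.
move=> W; have [d1 d2] := W1inf_dtau_ae W; have [b1 b2] := bdm_dtau W.
have [K [l1 l2]] := W1inf_lip W.
by split; [rewrite -(lip01_ftc1 l1 b1 d1)|rewrite -(lip01_ftc1 l2 b2 d2)].
Qed.

Lemma W1inf_poincare (xi : R -> R * R) : W1inf xi -> xi 0 = 0 ->
  RI (fun t => dot (xi t) (xi t)) <= RI (fun t => dot (dtau xi t) (dtau xi t)).
Proof.
move=> W x0; have [d1 d2] := W1inf_dtau_ae W; have [b1 b2] := bdm_dtau W.
have [K [l1 l2]] := W1inf_lip W; have [c1 c2] := bdm_W1inf W.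
rewrite -[leRHS]RI_cst; apply: ae_le_RI; [exact: bdm_dot|exact: bdm_cst|].
apply: aeW => t It; rewrite /dot RID; [|exact: bdmM..].
have := lip01_poincare l1 b1 d1 (I01_sub01 It).
have := lip01_poincare l2 b2 d2 (I01_sub01 It).
by rewrite x0/= !subr0 -!expr2 => h2 h1; exact: lerD.
Qed.

End primitives.

(** * Second derivatives of the travel time density *)

Section partial_derivatives.
Variable R : realType.
Implicit Types (phi : R * R -> R) (x y u e : R * R).

Definition e1 : R * R := (1, 0).
Definition e2 : R * R := (0, 1).

Lemma is_derive_line (V : normedModType R) (phi : R * R -> V) x y (s : R) d :
  is_derive (x + s *: y) y phi d ->
  is_derive s 1 (fun s => phi (x + s *: y)) d.
Proof.
move=> [dphi <-].
have E : (fun h : R => h^-1 *: (((fun s => phi (x + s *: y)) \o shift s) (h *: 1)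
     - phi (x + s *: y))) =
  (fun h : R => h^-1 *: ((phi \o shift (x + s *: y)) (h *: y) - phi (x + s *: y))).
  apply/funext => h /=; congr (_ *: (phi _ - _)).
  by rewrite [h *: 1]mulr1 scalerDl addrCA.
by split; rewrite /derivable /derive E.
Qed.

Lemma line_mvt phi e x (r : R) : (forall x, derivable phi x e) ->
  exists2 c, `|c| <= `|r| & phi (x + r *: e) - phi x = r * 'D_e phi (x + c *: e).
Proof.
move=> dphi.
pose psi s := phi (x + s *: e).
have dpsi (s : R) : is_derive s 1 psi ('D_e phi (x + s *: e)).
  by apply: is_derive_line; exact: DeriveDef.
have cpsi (a b : R) : {within `[a, b], continuous psi}.
  apply: continuous_subspaceT => s; apply: differentiable_continuous.
  by apply/derivable1_diffP; have [] := dpsi s.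
have p0 : phi x = psi 0 by rewrite /psi scale0r addr0.
have [r0|/ltW r0] := leP 0 r.
  have [c /[!in_itv]/= /andP[c0 cr] cE] := MVT_segment r0 (fun s _ => dpsi s) (cpsi 0 r).
  exists c; first by rewrite !ger0_norm.
  by rewrite p0 -/(psi r) cE subr0 mulrC.
have [c /[!in_itv]/= /andP[rc c0] cE] := MVT_segment r0 (fun s _ => dpsi s) (cpsi r 0).
exists c; first by rewrite !ler0_norm ?lerN2.
by rewrite p0 -/(psi r) -opprB cE sub0r mulrN opprK mulrC.
Qed.

(** [C3] speaks of one direction at a time and says nothing of linearity in the direction. Linearity
    follows from continuity of the partial derivatives: [x + h u] is reached by two moves parallel
    to the axes, with the mean value theorem on each. *)
Lemma partials_is_derive phi x u :
  (forall x, derivable phi x e1) -> (forall x, derivable phi x e2) ->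
  continuous ('D_e1 phi) -> continuous ('D_e2 phi) ->
  is_derive x u phi (u.1 * 'D_e1 phi x + u.2 * 'D_e2 phi x).
Proof.
move=> d1 d2 c1 c2.
have H : (fun h => h^-1 *: ((phi \o shift x) (h *: u) - phi x)) @ 0^' -->
    u.1 * 'D_e1 phi x + u.2 * 'D_e2 phi x.
  apply/cvgrPdist_le => e e0.
  pose M := `|u.1| + `|u.2| + 1.
  have M0 : 0 < M by rewrite /M; have := normr_ge0 u.1; have := normr_ge0 u.2; lra.
  have eM0 : 0 < e / M by exact: divr_gt0.
  have /cvgrPdist_le/(_ _ eM0)/nbhs_ballP[r1 /= r10 H1] := c1 x.
  have /cvgrPdist_le/(_ _ eM0)/nbhs_ballP[r2 /= r20 H2] := c2 x.
  pose r := Num.min r1 r2.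
  have r0 : 0 < r by rewrite lt_min r10.
  exists (r / M) => /=; first exact: divr_gt0.
  move=> h /=; rewrite sub0r normrN ltr_pdivlMr// => hr h0.
  have hu1 : `|h * u.1| < r.
    apply: le_lt_trans hr; rewrite normrM ler_wpM2l// /M.
    by have := normr_ge0 u.2; lra.
  have hu2 : `|h * u.2| < r.
    apply: le_lt_trans hr; rewrite normrM ler_wpM2l// /M.
    by have := normr_ge0 u.1; lra.
  have [a ale aE] := line_mvt (phi := phi) x (h * u.1) d1.
  have [b ble bE] := line_mvt (phi := phi) (x + (h * u.1) *: e1) (h * u.2) d2.
  have E1 : `|'D_e1 phi x - 'D_e1 phi (x + a *: e1)| <= e / M.
    apply: H1; split => /=; rewrite /ball/= opprD addrA subrr add0r ?normrN /e1/=.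
      by rewrite [a *: 1]mulr1; apply: le_lt_trans ale (lt_le_trans hu1 _); rewrite ge_min lexx.
    by rewrite scaler0 normr0.
  have E2 : `|'D_e2 phi x - 'D_e2 phi (x + (h * u.1) *: e1 + b *: e2)| <= e / M.
    apply: H2; split => /=; rewrite /ball/= -addrA opprD addrA subrr add0r ?normrN /e1 /e2/=.
      rewrite scaler0 addr0 [_ *: 1]mulr1; apply: lt_le_trans hu1 _.
      by rewrite ge_min lexx orbT.
    rewrite scaler0 add0r [_ *: 1]mulr1; apply: le_lt_trans ble (lt_le_trans hu2 _).
    by rewrite ge_min lexx orbT.
  have hE : h *: u + x = x + (h * u.1) *: e1 + (h * u.2) *: e2.
    rewrite addrC -addrA; congr (_ + _); rewrite /e1 /e2.
    case: u {M M0 eM0 H1 H2 r r0 hr hu1 hu2 a ale aE b ble bE E1 E2} => u1 u2.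
    by congr (_, _) => /=; rewrite ?scaler0 ?addr0 ?add0r [_ *: 1]mulr1.
  rewrite /= hE; set X1 := x + (h * u.1) *: e1 in aE bE E2 *.
  have -> : phi (X1 + (h * u.2) *: e2) - phi x =
    (phi (X1 + (h * u.2) *: e2) - phi X1) + (phi X1 - phi x) by rewrite addrA subrK.
  rewrite aE bE.
  rewrite [_ *: _](_ : _ = u.2 * 'D_e2 phi (X1 + b *: e2) +
    u.1 * 'D_e1 phi (x + a *: e1)); last first.
    rewrite /GRing.scale/=; field; exact: h0.
  set A := 'D_e1 phi x in E1 *; set A' := 'D_e1 phi _ in E1 *.
  set B := 'D_e2 phi x in E2 *; set B' := 'D_e2 phi _ in E2 *.
  rewrite (_ : _ - _ = u.1 * (A - A') + u.2 * (B - B')); last by ring.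
  apply: le_trans (ler_normD _ _) _; rewrite !normrM.
  apply: (@le_trans _ _ (`|u.1| * (e / M) + `|u.2| * (e / M))).
    by apply: lerD; apply: ler_wpM2l.
  rewrite -mulrDl mulrA ler_pdivrMr// mulrC ler_pM2l// /M; lra.
split; first by apply/cvg_ex; eexists; exact: H.
exact/cvg_lim.
Qed.

Lemma derivable_proj (pr : R * R -> R) (w : R * R -> R * R) x u :
  continuous pr -> (forall p q, pr (p - q) = pr p - pr q) ->
  (forall (c : R) p, pr (c *: p) = c * pr p) ->
  derivable w x u ->
  is_derive x u (fun y => pr (w y)) (pr ('D_u w x)).
Proof.
move=> cpr prB prZ dw.
have H : (fun h : R => h^-1 *: (((fun y => pr (w y)) \o shift x) (h *: u) - pr (w x))) @ 0^' -->
    pr ('D_u w x).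
  rewrite (_ : (fun h => _) = (fun h : R => pr (h^-1 *: ((w \o shift x) (h *: u) - w x)))).
    by apply: continuous_cvg; [exact: cpr|exact: dw].
  by apply/funext => h /=; rewrite prZ prB.
split; first by apply/cvg_ex; eexists; exact: H.
exact/cvg_lim.
Qed.

End partial_derivatives.

Section scalar_derivatives.
Variable R : realType.
Implicit Types (f g a b c : R -> R) (s : R).

Lemma isdD f g s df dg : is_derive s 1 f df -> is_derive s 1 g dg ->
  is_derive s 1 (fun s => f s + g s) (df + dg).
Proof. exact: is_deriveD. Qed.

Lemma isdB f g s df dg : is_derive s 1 f df -> is_derive s 1 g dg ->
  is_derive s 1 (fun s => f s - g s) (df - dg).
Proof. exact: is_deriveB. Qed.

Lemma isdN f s df : is_derive s 1 f df -> is_derive s 1 (fun s => - f s) (- df).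
Proof. exact: is_deriveN. Qed.

Lemma isdM f g s df dg : is_derive s 1 f df -> is_derive s 1 g dg ->
  is_derive s 1 (fun s => f s * g s) (f s * dg + g s * df).
Proof. exact: is_deriveM. Qed.

Lemma isdZ k f s df : is_derive s 1 f df -> is_derive s 1 (fun s => k * f s) (k * df).
Proof. exact: is_deriveZ. Qed.

Lemma isdV f s df : f s != 0 -> is_derive s 1 f df ->
  is_derive s 1 (fun s => (f s)^-1) (- (f s) ^- 2 * df).
Proof. exact: is_deriveV. Qed.

Lemma isd_sqr f s df : is_derive s 1 f df ->
  is_derive s 1 (fun s => f s ^+ 2) (2 * f s * df).
Proof.
move=> h; apply: is_derive_eq (isdM h h) _; ring.
Qed.

Lemma isd_eq f s d d' : is_derive s 1 f d -> d = d' -> is_derive s 1 f d'.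
Proof. by move=> h <-. Qed.

(** [fspeed] is this root for [a = p . w], [b = vbar^2 - |w|^2] and [c = |p|^2]. The number
    [b phi + a] is half the derivative of the quadratic at the root, hence the denominator in
    implicit differentiation; its positivity makes the division legitimate. *)
Lemma quadratic_root (a b c : R) : 0 < b -> 0 < c ->
  let phi := (- a + Num.sqrt (a ^+ 2 + b * c)) / b in
  [/\ b * phi + a = Num.sqrt (a ^+ 2 + b * c), 0 < b * phi + a &
      b * phi ^+ 2 + 2 * a * phi - c = 0].
Proof.
move=> b0 c0 phi.
have D0 : 0 < a ^+ 2 + b * c by rewrite ltr_wpDl ?sqr_ge0// mulr_gt0.
have E : b * phi + a = Num.sqrt (a ^+ 2 + b * c).
  by rewrite /phi; field; rewrite gt_eqF.
split => //; first by rewrite E sqrtr_gt0.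
have : (b * phi + a) ^+ 2 = a ^+ 2 + b * c by rewrite E sqr_sqrtr// ltW.
move=> h; apply: (mulfI (lt0r_neq0 b0)); rewrite mulr0.
have -> : b * (b * phi ^+ 2 + 2 * a * phi - c) = (b * phi + a) ^+ 2 - (a ^+ 2 + b * c) by ring.
by rewrite h subrr.
Qed.

(* Obtained by differentiating [b phi^2 + 2 a phi - c = 0], as is the next lemma. *)
Lemma quadratic_root_derive a b c s (a' b' c' : R) :
  is_derive s 1 a a' -> is_derive s 1 b b' -> is_derive s 1 c c' ->
  0 < b s -> 0 < c s ->
  let phi s := (- a s + Num.sqrt (a s ^+ 2 + b s * c s)) / b s in
  is_derive s 1 phi
    ((c' - b' * phi s ^+ 2 - 2 * a' * phi s) / (2 * (b s * phi s + a s))).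
Proof.
move=> ha hb hc b0 c0 phi.
have [E r0 Q] := quadratic_root (a s) b0 c0.
have D0 : 0 < a s ^+ 2 + b s * c s by rewrite ltr_wpDl ?sqr_ge0// mulr_gt0.
have hD := isdD (isd_sqr ha) (isdM hb hc).
have hr : is_derive s 1 (fun s => Num.sqrt (a s ^+ 2 + b s * c s)) _ :=
  @is_derive1_comp _ Num.sqrt (fun s => a s ^+ 2 + b s * c s) s _ _
    (is_derive1_sqrt D0) hD.
have hp := isdM (isdD (isdN ha) hr) (isdV (lt0r_neq0 b0) hb).
apply: (isd_eq hp).
rewrite -/(phi s) in E r0 Q.
have bn : b s != 0 by exact: lt0r_neq0.
have rn : b s * phi s + a s != 0 by exact: lt0r_neq0.
rewrite -E.
have -> : c s = b s * phi s ^+ 2 + 2 * a s * phi s by apply/eqP; rewrite eq_sym -subr_eq0 Q.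
field.
by rewrite rn bn.
Qed.

Lemma quadratic_root_derive2 a b (phi a1 b1 c1 : R -> R) s (a2 b2 c2 : R) :
  is_derive s 1 a (a1 s) -> is_derive s 1 b (b1 s) ->
  is_derive s 1 a1 a2 -> is_derive s 1 b1 b2 -> is_derive s 1 c1 c2 ->
  let phi1 s := (c1 s - b1 s * phi s ^+ 2 - 2 * a1 s * phi s) / (2 * (b s * phi s + a s)) in
  is_derive s 1 phi (phi1 s) ->
  b s * phi s + a s != 0 ->
  is_derive s 1 phi1
    ((c2 - b2 * phi s ^+ 2 - 4 * b1 s * phi s * phi1 s - 2 * b s * phi1 s ^+ 2
      - 2 * a2 * phi s - 4 * a1 s * phi1 s) / (2 * (b s * phi s + a s))).
Proof.
move=> ha hb ha1 hb1 hc1 phi1 hphi rn.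
have r2 : 2 * (b s * phi s + a s) != 0 by rewrite mulf_neq0// pnatr_eq0.
have hN := isdB (isdB hc1 (isdM hb1 (isd_sqr hphi))) (isdM (isdZ 2 ha1) hphi).
have hV := @isdV (fun s => 2 * (b s * phi s + a s)) s _ r2
  (isdZ 2 (isdD (isdM hb hphi) ha)).
have hp := isdM hN hV.
apply: (isd_eq hp).
(* Writing the numerator as [phi1 s] times the denominator expresses the derivative of the quotient
   through [phi1 s] itself. *)
have N : c1 s - b1 s * phi s ^+ 2 - 2 * a1 s * phi s = phi1 s * (2 * (b s * phi s + a s)).
  by rewrite /phi1 divfK.
rewrite N; field; exact: rn.
Qed.

End scalar_derivatives.

(** * The travel time density along a line *)

Section second_variation.
Variables (R : realType) (vbar : R) (w : R * R -> R * R).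
Implicit Types x p y q : R * R.

(** Written through the partial derivatives, so that linearity of [Dw] and homogeneity of degree 2
    of [DDw] in [y] are visible. *)
Definition Dw x y : R * R := y.1 *: D1 w x (e1 R) + y.2 *: D1 w x (e2 R).
Definition DDw x y : R * R :=
  y.1 *: (y.1 *: D2 w x (e1 R) (e1 R) + y.2 *: D2 w x (e1 R) (e2 R)) +
  y.2 *: (y.1 *: D2 w x (e2 R) (e1 R) + y.2 *: D2 w x (e2 R) (e2 R)).

(** The leading coefficient of the quadratic equation for [fspeed]. Below, [fa1], [fa2] are the
    first two derivatives of [p . w] and [fb1], [fb2] those of [fb], along the line with direction
    [(y, q)]. *)
Definition fb x := vbar ^+ 2 - dot (w x) (w x).
Definition fr x p := fb x * fspeed vbar w x p + dot p (w x).
Definition fa1 x p y q := dot q (w x) + dot p (Dw x y).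
Definition fb1 x y := - (2 * dot (w x) (Dw x y)).
Definition fa2 x p y q := 2 * dot q (Dw x y) + dot p (DDw x y).
Definition fb2 x y := - (2 * (dot (Dw x y) (Dw x y) + dot (w x) (DDw x y))).
(* [F1] and [F2] are the first two derivatives of [s |-> fspeed (x + s y) (p + s q)] at
   [s = 0], read off the equation [fb f^2 + 2 (p . w) f = p . p] solved by [fspeed];
   [fr] is its discriminant root, so both are junk at [p = 0]. *)
Definition F1 x p y q :=
  (2 * dot p q - fb1 x y * fspeed vbar w x p ^+ 2
   - 2 * fa1 x p y q * fspeed vbar w x p) / (2 * fr x p).
Definition F2 x p y q :=
  (2 * dot q q - fb2 x y * fspeed vbar w x p ^+ 2
   - 4 * fb1 x y * fspeed vbar w x p * F1 x p y q - 2 * fb x * F1 x p y q ^+ 2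
   - 2 * fa2 x p y q * fspeed vbar w x p - 4 * fa1 x p y q * F1 x p y q)
  / (2 * fr x p).

Lemma dotZl (k : R) p q : dot (k *: p) q = k * dot p q.
Proof. by rewrite /dot/= /GRing.scale/= mulrDr !mulrA. Qed.

Lemma dotZr (k : R) p q : dot p (k *: q) = k * dot p q.
Proof. by rewrite /dot/= /GRing.scale/= mulrDr 2!(mulrCA k). Qed.

Lemma DwZ (k : R) x y : Dw x (k *: y) = k *: Dw x y.
Proof.
rewrite /Dw; move: (D1 w x _) (D1 w x _) => a b.
by rewrite scalerDr !scalerA.
Qed.

Lemma DDwZ (k : R) x y : DDw x (k *: y) = k ^+ 2 *: DDw x y.
Proof.
rewrite /DDw; move: (D2 w x _ _) (D2 w x _ _) (D2 w x _ _) (D2 w x _ _) => A B C D.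
rewrite (_ : (k *: y).1 = k * y.1)// (_ : (k *: y).2 = k * y.2)//.
have E (V : lmodType R) (a c : V) (r : R) :
    (k * r) *: ((k * y.1) *: a + (k * y.2) *: c) = k ^+ 2 *: (r *: (y.1 *: a + y.2 *: c)).
  rewrite -!(scalerA k) -scalerDr !scalerA; congr (_ *: _); ring.
by rewrite !E -scalerDr.
Qed.

Lemma fa1Z (k : R) x p y q : fa1 x p (k *: y) (k *: q) = k * fa1 x p y q.
Proof.
rewrite /fa1 DwZ; move: (Dw x y) (w x) => A B.
by rewrite (dotZl k q B) (dotZr k p A); ring.
Qed.

Lemma fb1Z (k : R) x y : fb1 x (k *: y) = k * fb1 x y.
Proof.
rewrite /fb1 DwZ; move: (Dw x y) (w x) => A B.
by rewrite (dotZr k B A); ring.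
Qed.

Lemma fa2Z (k : R) x p y q : fa2 x p (k *: y) (k *: q) = k ^+ 2 * fa2 x p y q.
Proof.
rewrite /fa2 DwZ DDwZ; move: (Dw x y) (DDw x y) => A B.
by rewrite (dotZl k q) (dotZr k q A) (dotZr (k ^+ 2) p B); ring.
Qed.

Lemma fb2Z (k : R) x y : fb2 x (k *: y) = k ^+ 2 * fb2 x y.
Proof.
rewrite /fb2 DwZ DDwZ; move: (Dw x y) (DDw x y) (w x) => A B C.
by rewrite (dotZl k A) (dotZr k A A) (dotZr (k ^+ 2) C B); ring.
Qed.

Lemma F1Z (k : R) x p y q : F1 x p (k *: y) (k *: q) = k * F1 x p y q.
Proof.
rewrite /F1 fb1Z fa1Z (dotZr k p q) [RHS]mulrA; congr (_ / _).
move: (dot _ _) (fb1 _ _) (fspeed _ _ _ _) (fa1 _ _ _ _) => A B C D; ring.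
Qed.

(** Every summand of the numerator has degree 2 in [(y, q)], and the denominator is free of them. *)
Lemma F2Z (k : R) x p y q : F2 x p (k *: y) (k *: q) = k ^+ 2 * F2 x p y q.
Proof.
rewrite /F2 fb1Z fa1Z fb2Z fa2Z F1Z (dotZl k q) (dotZr k q q) [RHS]mulrA; congr (_ / _).
move: (dot _ _) (fb1 _ _) (fspeed _ _ _ _) (fa1 _ _ _ _) (fb2 _ _) (fa2 _ _ _ _)
  (F1 _ _ _ _) (fb _) => A B C D E F G H; ring.
Qed.

Definition isd2 (u : R -> R * R) (s : R) (du : R * R) :=
  is_derive s 1 (fun s => (u s).1) du.1 /\ is_derive s 1 (fun s => (u s).2) du.2.

Lemma isd_dot u v (s : R) du dv : isd2 u s du -> isd2 v s dv ->
  is_derive s 1 (fun s => dot (u s) (v s)) (dot du (v s) + dot (u s) dv).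
Proof.
move=> [u1 u2] [v1 v2]; rewrite /dot.
by apply: (isd_eq (isdD (isdM u1 v1) (isdM u2 v2))); ring.
Qed.

Lemma isd2_line p q (s : R) : isd2 (fun s => p + s *: q) s q.
Proof.
have H (a b : R) : is_derive s 1 (fun s => a + s * b) b.
  apply: isd_eq (isdD (is_derive_cst a s 1) (isdM (is_derive_id s 1) (is_derive_cst b s 1))) _.
  by rewrite mulr0 !add0r mulr1.
by split; exact: H.
Qed.

Lemma C1_line (g : R * R -> R * R) x y (s : R) :
  (forall x, derivable g x (e1 R)) -> (forall x, derivable g x (e2 R)) ->
  continuous (fun x => 'D_(e1 R) g x) -> continuous (fun x => 'D_(e2 R) g x) ->
  isd2 (fun s => g (x + s *: y)) s
    (y.1 *: 'D_(e1 R) g (x + s *: y) + y.2 *: 'D_(e2 R) g (x + s *: y)).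
Proof.
move=> d1 d2 c1 c2.
suff H (pr : R * R -> R) : continuous pr -> (forall p q, pr (p - q) = pr p - pr q) ->
    (forall (c : R) p, pr (c *: p) = c * pr p) ->
    is_derive s 1 (fun s => pr (g (x + s *: y)))
      (y.1 * pr ('D_(e1 R) g (x + s *: y)) + y.2 * pr ('D_(e2 R) g (x + s *: y))).
  by split; apply: H => // z; [exact: cvg_fst|exact: cvg_snd].
move=> cpr prB prZ.
have E1 z : is_derive z (e1 R) (fun z => pr (g z)) (pr ('D_(e1 R) g z)).
  exact: derivable_proj.
have E2 z : is_derive z (e2 R) (fun z => pr (g z)) (pr ('D_(e2 R) g z)).
  exact: derivable_proj.
have E1f : 'D_(e1 R) (fun z => pr (g z)) = (fun z => pr ('D_(e1 R) g z)).
  by apply/funext => z; have [_ ->] := E1 z.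
have E2f : 'D_(e2 R) (fun z => pr (g z)) = (fun z => pr ('D_(e2 R) g z)).
  by apply/funext => z; have [_ ->] := E2 z.
have HP : is_derive (x + s *: y) y (fun z => pr (g z))
    (y.1 * 'D_(e1 R) (fun z => pr (g z)) (x + s *: y) +
     y.2 * 'D_(e2 R) (fun z => pr (g z)) (x + s *: y)).
  apply: partials_is_derive.
  - by move=> z; have [] := E1 z.
  - by move=> z; have [] := E2 z.
  - by rewrite E1f => z; apply: continuous_comp; [exact: c1|exact: cpr].
  - by rewrite E2f => z; apply: continuous_comp; [exact: c2|exact: cpr].
have [_ V1] := E1 (x + s *: y); have [_ V2] := E2 (x + s *: y).
by rewrite V1 V2 in HP; exact: (is_derive_line HP).
Qed.

Lemma isd2_comb (u v : R -> R * R) (k l s : R) du dv : isd2 u s du -> isd2 v s dv ->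
  isd2 (fun s => k *: u s + l *: v s) s (k *: du + l *: dv).
Proof. by move=> [u1 u2] [v1 v2]; split; apply: isdD; exact: isdZ. Qed.

Hypothesis w3 : C3 w.
Hypothesis wv : forall x, enorm (w x) < vbar.
Hypothesis vbar0 : 0 < vbar.

Lemma fb_gt0 x : 0 < fb x.
Proof.
rewrite /fb subr_gt0 -enorm_sqr ltr_pXn2r// ?nnegrE ?enorm_ge0//; exact: ltW.
Qed.

Lemma isd2_w x y (s : R) : isd2 (fun s => w (x + s *: y)) s (Dw (x + s *: y) y).
Proof.
have [cw H] := w3.
apply: C1_line.
- by move=> z; have [h _] := H (e1 R) 0 0; exact: h.
- by move=> z; have [h _] := H (e2 R) 0 0; exact: h.
- by have [_ [h _]] := H (e1 R) 0 0; exact: h.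
- by have [_ [h _]] := H (e2 R) 0 0; exact: h.
Qed.

Lemma isd2_Dw x y (s : R) : isd2 (fun s => Dw (x + s *: y) y) s (DDw (x + s *: y) y).
Proof.
have [cw H] := w3.
have L u : isd2 (fun s => D1 w (x + s *: y) u) s
    (y.1 *: D2 w (x + s *: y) u (e1 R) + y.2 *: D2 w (x + s *: y) u (e2 R)).
  apply: C1_line.
  - by move=> z; have [_ [_ [h _]]] := H u (e1 R) 0; exact: h.
  - by move=> z; have [_ [_ [h _]]] := H u (e2 R) 0; exact: h.
  - by have [_ [_ [_ [h _]]]] := H u (e1 R) 0; exact: h.
  - by have [_ [_ [_ [h _]]]] := H u (e2 R) 0; exact: h.
rewrite /Dw /DDw; exact: (isd2_comb _ _ (L (e1 R)) (L (e2 R))).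
Qed.

Section line.
Variables x p y q : R * R.
Let a s := dot (p + s *: q) (w (x + s *: y)).
Let b s := fb (x + s *: y).
Let c s := dot (p + s *: q) (p + s *: q).

Let ha (s : R) : is_derive s 1 a (fa1 (x + s *: y) (p + s *: q) y q).
Proof. exact: isd_dot (isd2_line p q s) (isd2_w x y s). Qed.

Let hb (s : R) : is_derive s 1 b (fb1 (x + s *: y) y).
Proof.
apply: isd_eq (isdB (is_derive_cst _ _ _) (isd_dot (isd2_w x y s) (isd2_w x y s))) _.
by rewrite /fb1; move: (w _) (Dw _ _) => W W1; rewrite /dot; ring.
Qed.

Let hc (s : R) : is_derive s 1 c (2 * dot (p + s *: q) q).
Proof.
apply: isd_eq (isd_dot (isd2_line p q s) (isd2_line p q s)) _.
by move: (p + s *: q) => P; rewrite /dot; ring.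
Qed.

Lemma fspeed_line (s : R) : 0 < dot (p + s *: q) (p + s *: q) ->
  is_derive s 1 (fun s => fspeed vbar w (x + s *: y) (p + s *: q))
    (F1 (x + s *: y) (p + s *: q) y q).
Proof.
move=> p0; exact: (quadratic_root_derive (ha s) (hb s) (hc s) (fb_gt0 _) p0).
Qed.

Lemma fr_gt0 x' p' : 0 < dot p' p' -> 0 < fr x' p'.
Proof. by move=> p0; have [] := quadratic_root (dot p' (w x')) (fb_gt0 x') p0. Qed.

Lemma F1_line (s : R) : 0 < dot (p + s *: q) (p + s *: q) ->
  is_derive s 1 (fun s => F1 (x + s *: y) (p + s *: q) y q)
    (F2 (x + s *: y) (p + s *: q) y q).
Proof.
move=> p0.
have cq : isd2 (fun=> q) s 0 by split; exact: is_derive_cst.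
have ha1 : is_derive s 1 (fun s => fa1 (x + s *: y) (p + s *: q) y q)
    (fa2 (x + s *: y) (p + s *: q) y q).
  apply: isd_eq (isdD (isd_dot cq (isd2_w x y s)) (isd_dot (isd2_line p q s) (isd2_Dw x y s))) _.
  rewrite /fa2; move: (w _) (Dw _ _) (DDw _ _) (p + s *: q) => W W1 W2 P.
  by rewrite /dot/=; ring.
have hb1 : is_derive s 1 (fun s => fb1 (x + s *: y) y) (fb2 (x + s *: y) y).
  apply: isd_eq (isdN (isdZ 2 (isd_dot (isd2_w x y s) (isd2_Dw x y s)))) _.
  by rewrite /fb2.
have hc1 : is_derive s 1 (fun s => 2 * dot (p + s *: q) q) (2 * dot q q).
  apply: isd_eq (isdZ 2 (isd_dot (isd2_line p q s) cq)) _.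
  by move: (p + s *: q) => P; rewrite /dot/=; ring.
exact: (quadratic_root_derive2 (ha s) (hb s) ha1 hb1 hc1 (fspeed_line p0)
  (lt0r_neq0 (fr_gt0 _ p0))).
Qed.

End line.

(* [A] stands for continuity at a point or for measurability on a set: both are stable
   under the operations out of which [fspeed], [F1] and [F2] are built. *)
Section closure.
Variables (S : Type) (Dom : set S) (A : (S -> R) -> Prop).
Hypothesis AC : forall k, A (fun=> k).
Hypothesis AD : forall f g, A f -> A g -> A (fun z => f z + g z).
Hypothesis AN : forall f, A f -> A (fun z => - f z).
Hypothesis AM : forall f g, A f -> A g -> A (fun z => f z * g z).
Hypothesis AS : forall f, A f -> A (fun z => Num.sqrt (f z)).
Hypothesis AV : forall f, A f -> (forall z, Dom z -> f z != 0) -> A (fun z => (f z)^-1).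

Let A2 (u : S -> R * R) := A (fun z => (u z).1) /\ A (fun z => (u z).2).

Let A2D u v : A2 u -> A2 v -> A2 (fun z => u z + v z).
Proof. by move=> [u1 u2] [v1 v2]; split; exact: AD. Qed.

Let A2Z f v : A f -> A2 v -> A2 (fun z => f z *: v z).
Proof. by move=> fA [v1 v2]; split; exact: AM. Qed.

Let Adot u v : A2 u -> A2 v -> A (fun z => dot (u z) (v z)).
Proof. by move=> [u1 u2] [v1 v2]; apply: AD; exact: AM. Qed.

Let AB f g : A f -> A g -> A (fun z => f z - g z).
Proof. by move=> fA gA; apply: AD => //; exact: AN. Qed.

Let Asqr f : A f -> A (fun z => f z ^+ 2).
Proof. by move=> fA; apply: (AM fA fA). Qed.

Variables (x p y q : S -> R * R).
Hypothesis Aw : A2 (fun z => w (x z)).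
Hypothesis AD1 : forall u, A2 (fun z => D1 w (x z) u).
Hypothesis AD2 : forall u v, A2 (fun z => D2 w (x z) u v).
Hypotheses (Ap : A2 p) (Ay : A2 y) (Aq : A2 q).

Let Afb : A (fun z => fb (x z)).
Proof. by apply: AB; [exact: AC|exact: Adot]. Qed.

Lemma closure_fspeed : A (fun z => fspeed vbar w (x z) (p z)).
Proof.
apply: AM; last by apply: AV => // z _; exact/lt0r_neq0/fb_gt0.
apply: AD; first by apply: AN; exact: Adot.
apply: AS; apply: AD; first by apply: Asqr; exact: Adot.
by apply: AM => //; exact: Adot.
Qed.

Hypothesis p0 : forall z, Dom z -> 0 < dot (p z) (p z).

Let Ar : A (fun z => (2 * fr (x z) (p z))^-1).
Proof.
apply: AV; last first.
  by move=> z /p0 h; rewrite mulf_neq0 ?pnatr_eq0//; exact/lt0r_neq0/fr_gt0.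
apply: AM; first exact: AC.
by apply: AD; [apply: AM => //; exact: closure_fspeed|exact: Adot].
Qed.

Let ADw : A2 (fun z => Dw (x z) (y z)).
Proof. by apply: A2D; apply: A2Z; [exact: Ay.1|exact: AD1|exact: Ay.2|exact: AD1]. Qed.

Let ADDw : A2 (fun z => DDw (x z) (y z)).
Proof.
have [y1 y2] := Ay.
have L u := A2D (A2Z y1 (AD2 u (e1 R))) (A2Z y2 (AD2 u (e2 R))).
exact: (A2D (A2Z y1 (L (e1 R))) (A2Z y2 (L (e2 R)))).
Qed.

Let Afa1 : A (fun z => fa1 (x z) (p z) (y z) (q z)).
Proof. by apply: AD; exact: Adot. Qed.

Let Afb1 : A (fun z => fb1 (x z) (y z)).
Proof. by apply: AN; apply: AM; [exact: AC|exact: Adot]. Qed.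

Lemma closure_F1 : A (fun z => F1 (x z) (p z) (y z) (q z)).
Proof.
have f := closure_fspeed.
apply: AM => //; apply: AB; first apply: AB.
- by apply: AM; [exact: AC|exact: Adot].
- by apply: AM => //; exact: Asqr.
- by apply: AM => //; apply: AM => //; exact: AC.
Qed.

Lemma closure_F2 : A (fun z => F2 (x z) (p z) (y z) (q z)).
Proof.
have f := closure_fspeed; have f1 := closure_F1.
have k2 := AC 2; have k4 := AC 4.
have t1 := AM k2 (Adot Aq Aq).
have t2 := AM (AN (AM k2 (AD (Adot ADw ADw) (Adot Aw ADDw)))) (Asqr f).
have t3 := AM (AM (AM k4 Afb1) f) f1.
have t4 := AM (AM k2 Afb) (Asqr f1).
have t5 := AM (AM k2 (AD (AM k2 (Adot Aq ADw)) (Adot Ap ADDw))) f.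
have t6 := AM (AM k4 Afa1) f1.
exact: (AM (AB (AB (AB (AB (AB t1 t2) t3) t4) t5) t6) Ar).
Qed.

End closure.
End second_variation.

(** * Uniform estimates *)

Section compactness.
Variables (R : realType) (Z : pseudoMetricType R).

(** Only [z] has to lie in [K]: continuity holds in the ambient space, so [z'] may leave the compact
    set, as perturbed jets do. *)
Lemma compact_unif_continuous (K : set Z) (F : Z -> R) (eps : R) :
  compact K -> (forall z, K z -> {for z, continuous F}) -> 0 < eps ->
  exists2 d, 0 < d & forall z z', K z -> ball z d z' -> `|F z - F z'| <= eps.
Proof.
move=> /compact_near_coveringP cK cF e0.
have [d/= d0 Hd] : \forall d \near (0 : R)^'+,
    K `<=` [set z | forall z', ball z d z' -> `|F z - F z'| <= eps].
  apply: cK => z Kz.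
  have e2 : 0 < eps / 2 by exact: divr_gt0.
  have /cvgrPdist_le/(_ _ e2)/nbhs_ballP[r/= r0 Hr] := cF z Kz.
  exists (ball z (r / 2), [set d : R | 0 < d < r / 2]).
    split; first by apply: nbhsx_ballx; exact: divr_gt0.
    exists (r / 2) => /=; first exact: divr_gt0.
    by move=> d/=; rewrite sub0r normrN => h d0; rewrite d0/= -(gtr0_norm d0).
  move=> [z1 d]/= [zz1 /andP[d0 dr]] z' z1z'.
  rewrite -(subrK (F z) (F z1)) -addrA; apply: le_trans (ler_normD _ _) _.
  rewrite [leRHS]splitr distrC; apply: lerD; apply: Hr.
    by apply: le_ball zz1; lra.
  apply: le_ball (ball_triangle zz1 z1z'); lra.
exists (d / 2); first exact: divr_gt0.
move=> z z' Kz; apply: (Hd (d / 2)) => //=.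
  by rewrite sub0r normrN gtr0_norm ?divr_gt0//; lra.
exact: divr_gt0.
Qed.

Lemma compact_continuous_bounded (K : set Z) (F : Z -> R) :
  compact K -> (forall z, K z -> {for z, continuous F}) ->
  exists C, forall z, K z -> `|F z| <= C.
Proof.
move=> /compact_near_coveringP cK cF.
have [C [_ HC]] : \forall C \near +oo, K `<=` [set z | `|F z| <= C].
  apply: cK => z Kz.
  have /cvgrPdist_le/(_ _ ltr01) Hr := cF z Kz.
  exists ([set z' | `|F z - F z'| <= 1], [set C : R | `|F z| + 1 < C]).
    by split => //; exists (`|F z| + 1); split; [exact: num_real|].
  move=> [z1 C]/= [h1 h2].
  have := ler_normB (F z) (F z - F z1); rewrite opprB addrC subrK; lra.
by exists (C + 1) => z Kz; apply: (HC (C + 1)) => //; lra.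
Qed.

End compactness.

Section uniform_estimates.
Variables (R : realType) (vbar : R) (w : R * R -> R * R).
Hypothesis w3 : C3 w.
Hypothesis wv : forall x, enorm (w x) < vbar.
Hypothesis vbar0 : 0 < vbar.
Let Z : Type := (((R * R) * (R * R)) * ((R * R) * (R * R)))%type.
Implicit Types x p y q : R * R.


Lemma F12_continuous (z : ((R * R) * (R * R)) * ((R * R) * (R * R))) :
  0 < dot z.1.2 z.1.2 ->
  {for z, continuous (fun z => F1 vbar w z.1.1 z.1.2 z.2.1 z.2.2)} /\
  {for z, continuous (fun z => F2 vbar w z.1.1 z.1.2 z.2.1 z.2.2)}.
Proof.
move=> p0; pose A (f : Z -> R) := f z' @[z' --> z] --> f z.
have AC k : A (fun=> k) by exact: cvg_cst.
have AD f g : A f -> A g -> A (fun z => f z + g z) by exact: cvgD.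
have AN f : A f -> A (fun z => - f z) by exact: cvgN.
have AM f g : A f -> A g -> A (fun z => f z * g z) by exact: cvgM.
have AS f : A f -> A (fun z => Num.sqrt (f z)).
  by move=> fA; apply: (cvg_comp f Num.sqrt fA); exact: sqrt_continuous.
have AV f : A f -> (forall z', [set z] z' -> f z' != 0) -> A (fun z => (f z)^-1).
  by move=> fA /(_ z erefl) fz; exact: cvgV.
have cfst (T U : topologicalType) (v : T * U) : fst v' @[v' --> v] --> v.1 by exact: cvg_fst.
have csnd (T U : topologicalType) (v : T * U) : snd v' @[v' --> v] --> v.2 by exact: cvg_snd.
have c11 : z'.1.1 @[z' --> z] --> z.1.1.
  by apply: (cvg_comp fst fst (cfst _ _ z)); exact: cfst.
have c12 : z'.1.2 @[z' --> z] --> z.1.2.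
  by apply: (cvg_comp fst snd (cfst _ _ z)); exact: csnd.
have c21 : z'.2.1 @[z' --> z] --> z.2.1.
  by apply: (cvg_comp snd fst (csnd _ _ z)); exact: cfst.
have c22 : z'.2.2 @[z' --> z] --> z.2.2.
  by apply: (cvg_comp snd snd (csnd _ _ z)); exact: csnd.
have A2 (u : Z -> R * R) : u z' @[z' --> z] --> u z ->
    A (fun z => (u z).1) /\ A (fun z => (u z).2).
  by move=> cu; split; [apply: (cvg_comp u fst cu); exact: cfst|
    apply: (cvg_comp u snd cu); exact: csnd].
have [cw H] := w3.
have Aw := A2 _ (cvg_comp _ w c11 (cw _)).
have AD1 u := A2 _ (cvg_comp _ (fun y => D1 w y u) c11 ((H u 0 0).2.1 _)).
have AD2 u v := A2 _ (cvg_comp _ (fun y => D2 w y u v) c11 ((H u v 0).2.2.2.1 _)).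
have Ap := A2 _ c12; have Ay := A2 _ c21; have Aq := A2 _ c22.
have p0' z' : [set z] z' -> 0 < dot z'.1.2 z'.1.2 by move=> ->.
split.
- exact: (@closure_F1 R vbar w wv vbar0 Z [set z] A AC AD AN AM AS AV
    (fun z => z.1.1) (fun z => z.1.2) (fun z => z.2.1) (fun z => z.2.2)).
- exact: (@closure_F2 R vbar w wv vbar0 Z [set z] A AC AD AN AM AS AV
    (fun z => z.1.1) (fun z => z.1.2) (fun z => z.2.1) (fun z => z.2.2)).
Qed.

Definition box (M : R) : set (R * R) := `[- M, M]%classic `*` `[- M, M]%classic.

Lemma compact_box M : compact (box M).
Proof. by apply: compact_setX; exact: segment_compact. Qed.

Lemma enorm_box x M : enorm x <= M -> box M x.
Proof.
move=> xM; split; rewrite /= in_itv/= -ler_norml; apply: le_trans xM.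
  exact: enorm_fst.
exact: enorm_snd.
Qed.

(** The lower bound on the velocity is a closed condition that keeps the set compact and away from
    the zero velocity, where the formulas for [F1] and [F2] fail. *)
Definition jets (M m : R) : set (((R * R) * (R * R)) * ((R * R) * (R * R))) :=
  ((box M `*` box M) `*` (box M `*` box M)) `&` [set z | m <= dot z.1.2 z.1.2].

Lemma compact_jets M m : compact (jets M m).
Proof.
apply: compact_closedI; first by do !apply: compact_setX; exact: segment_compact.
rewrite (_ : [set z | _] = (fun z : ((R * R) * (R * R)) * ((R * R) * (R * R)) =>
  dot z.1.2 z.1.2) @^-1` [set r | m <= r])//.
apply: closed_comp; last exact: closed_ge.
move=> z _.
have c12 : z'.1.2 @[z' --> z] --> z.1.2.
  by apply: (cvg_comp fst snd (cvg_fst)); exact: cvg_snd.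
have c1 : z'.1.2.1 @[z' --> z] --> z.1.2.1 by apply: (cvg_comp _ fst c12); exact: cvg_fst.
have c2 : z'.1.2.2 @[z' --> z] --> z.1.2.2 by apply: (cvg_comp _ snd c12); exact: cvg_snd.
by apply: cvgD; exact: cvgM.
Qed.

Lemma F12_bounded M m : 0 < m -> exists C, forall x p y q,
  enorm x <= M -> enorm p <= M -> enorm y <= M -> enorm q <= M -> m <= dot p p ->
  `|F1 vbar w x p y q| <= C /\ `|F2 vbar w x p y q| <= C.
Proof.
move=> m0.
have c z : jets M m z -> 0 < dot z.1.2 z.1.2.
  by move=> [_ /=]; exact: lt_le_trans.
have [C1 H1] := compact_continuous_bounded (@compact_jets M m)
  (fun z Jz => (F12_continuous (c z Jz)).1).
have [C2 H2] := compact_continuous_bounded (@compact_jets M m)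
  (fun z Jz => (F12_continuous (c z Jz)).2).
exists (Num.max C1 C2) => x p y q hx hp hy hq hm.
have J : jets M m ((x, p), (y, q)).
  by split => //; split; split; exact: enorm_box.
by split; rewrite le_max; apply/orP; [left; exact: (H1 _ J)|right; exact: (H2 _ J)].
Qed.

Definition qn y q := dot y y + dot q q.

Lemma qn_eq0 y q : qn y q = 0 -> y = 0 /\ q = 0.
Proof.
case: y => y1 y2; case: q => q1 q2; rewrite /qn /dot/= -!expr2 => h.
have := sqr_ge0 y1; have := sqr_ge0 y2; have := sqr_ge0 q1; have := sqr_ge0 q2.
move=> a1 a2 a3 a4.
have sq0 (r : R) : r ^+ 2 <= 0 -> r = 0.
  by move=> hr; apply/eqP; rewrite -sqrf_eq0 eq_le hr sqr_ge0.
by split; congr (_, _); apply: sq0; lra.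
Qed.

Lemma enorm_scale_le (k : R) y (c : R) : 0 <= c -> k ^+ 2 * dot y y <= c ^+ 2 ->
  enorm (k *: y) <= c.
Proof.
move=> c0 h; apply: enorm_le => //.
by apply: le_trans h; rewrite /dot/= /GRing.scale/=; lra.
Qed.

Lemma enorm_ball x y (d : R) : enorm (x - y) < d -> ball x d y.
Proof.
move=> h; split => /=; apply: le_lt_trans h.
  exact: (enorm_fst (x - y)).
exact: (enorm_snd (x - y)).
Qed.

(* Homogeneity of F2 in its last two arguments turns uniform continuity on a
   compact set into an estimate for arbitrary increments. *)
Lemma F2_unif M m eps : 0 < m -> 0 < eps -> exists2 eta, 0 < eta &
  forall x p y q x' p' y' q', enorm x <= M -> enorm p <= M -> m <= dot p p ->
    enorm (x - x') <= eta -> enorm (p - p') <= eta ->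
    `|F2 vbar w x p y q - F2 vbar w x' p' y' q'|
      <= eps * (qn y q + qn (y - y') (q - q') / eta ^+ 2).
Proof.
move=> m0 e0.
pose M' := Num.max M 1.
have c z : jets M' m z -> 0 < dot z.1.2 z.1.2.
  by move=> [_ /=]; exact: lt_le_trans.
have [d d0 Hd] := compact_unif_continuous (@compact_jets M' m)
  (fun z Jz => (F12_continuous (c z Jz)).2) e0.
have eta0 : 0 < d / 2 by exact: divr_gt0.
exists (d / 2) => // x p y q x' p' y' q' xM pM mp xx' pp'.
set N2 := qn y q + _.
have etasq0 : 0 < (d / 2) ^+ 2 by rewrite exprn_gt0.
have q0 u v : 0 <= qn u v by rewrite /qn addr_ge0// dot_ge0.
have N20 : 0 <= N2 by rewrite /N2 addr_ge0// divr_ge0// ltW.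
(* If [N2] vanishes there is nothing to rescale by; both directions are then zero, and so are both
   values of [F2]. *)
have [N2z|N2n] := eqVneq N2 0.
  have [h1 h2] : qn y q = 0 /\ qn (y - y') (q - q') / (d / 2) ^+ 2 = 0.
    have a1 := q0 y q; have a2 : 0 <= qn (y - y') (q - q') / (d / 2) ^+ 2.
      by rewrite divr_ge0// ltW.
    by move: N2z; rewrite /N2 => h; split; lra.
  have /qn_eq0[y0 q00] := h1.
  have /qn_eq0[] : qn (y - y') (q - q') = 0.
    by move: h2 => /eqP; rewrite mulf_eq0 invr_eq0 (gt_eqF etasq0) orbF => /eqP.
  rewrite y0 q00 !sub0r => /eqP; rewrite oppr_eq0 => /eqP -> /eqP; rewrite oppr_eq0 => /eqP ->.
  have F20 a b : F2 vbar w a b 0 0 = 0.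
    by rewrite -(scale0r (0 : R * R)) F2Z expr0n/= mul0r.
  by rewrite !F20 subrr normr0 mulr_ge0// ltW.
have N2p : 0 < N2 by rewrite lt_neqAle eq_sym N2n.
(* This one factor brings [(y, q)] to length at most 1 and the increment to length at most [d / 2];
   hence the division of the increment by the square of [eta] in the statement. *)
pose k := (Num.sqrt N2)^-1.
have kk : k ^+ 2 = N2^-1 by rewrite exprVn sqr_sqrtr.
have k0 : 0 < N2^-1 by rewrite invr_gt0.
have M1 : 1 <= M' by rewrite /M' le_max lexx orbT.
have MM : M <= M' by rewrite /M' le_max lexx.
have le1 a : 0 <= a -> a <= N2 -> k ^+ 2 * a <= 1 ^+ 2.
  by move=> a0 aN; rewrite kk expr1n mulrC ler_pdivrMr// mul1r.
have leta a : 0 <= a -> a / (d / 2) ^+ 2 <= N2 -> k ^+ 2 * a <= (d / 2) ^+ 2.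
  by move=> a0; rewrite kk ler_pdivrMr// => h; rewrite mulrC ler_pdivrMr// mulrC.
have sq1 : qn y q <= N2 by rewrite /N2 lerDl divr_ge0// ltW.
have sq2 : qn (y - y') (q - q') / (d / 2) ^+ 2 <= N2 by rewrite /N2 lerDr.
have J : jets M' m ((x, p), (k *: y, k *: q)).
  split => //; split; split; apply: enorm_box => /=; try lra.
  - apply: le_trans M1; apply: enorm_scale_le => //; apply: le1; first exact: dot_ge0.
    by apply: le_trans sq1; rewrite /qn lerDl dot_ge0.
  - apply: le_trans M1; apply: enorm_scale_le => //; apply: le1; first exact: dot_ge0.
    by apply: le_trans sq1; rewrite /qn lerDr dot_ge0.
have bb : ball ((x, p), (k *: y, k *: q)) d ((x', p'), (k *: y', k *: q')).
  have dd : d / 2 < d by lra.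
  split; split; apply: enorm_ball; apply: le_lt_trans dd => //=; rewrite -scalerBr.
  - apply: enorm_scale_le; first exact: ltW.
    apply: leta; first exact: dot_ge0.
    apply: le_trans sq2; rewrite ler_pM2r ?invr_gt0// /qn lerDl dot_ge0//.
  - apply: enorm_scale_le; first exact: ltW.
    apply: leta; first exact: dot_ge0.
    apply: le_trans sq2; rewrite ler_pM2r ?invr_gt0// /qn lerDr dot_ge0//.
have := Hd _ _ J bb; rewrite /= !F2Z -mulrBr normrM kk (gtr0_norm k0).
by rewrite mulrC ler_pdivrMr.
Qed.

End uniform_estimates.

(** * The second variation of the travel time *)

Section curve_tools.
Variable R : realType.
Notation mu := (@lebesgue_measure R).

Lemma lip01_comb F G K K' (s : R) : lip01 F K -> lip01 G K' ->
  lip01 (fun t => F t + s * G t) (K + `|s| * K').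
Proof.
move=> HF HG a b a0 b0.
rewrite (_ : _ - _ = (F a - F b) + s * (G a - G b)); last by ring.
apply: le_trans (ler_normD _ _) _; rewrite mulrDl; apply: lerD; first exact: HF.
by rewrite normrM -mulrA ler_wpM2l// HG.
Qed.

Lemma W1inf_comb (xi dxi : R -> R * R) (s : R) : W1inf xi -> W1inf dxi ->
  W1inf (fun t => xi t + s *: dxi t).
Proof.
move=> /W1inf_lip[K [l1 l2]] /W1inf_lip[K' [l1' l2']].
exact: (lip_W1inf (lip01_comb s l1 l1') (lip01_comb s l2 l2')).
Qed.

Lemma dtau_comb (xi dxi : R -> R * R) (s t : R) :
  derivable xi t 1 -> derivable dxi t 1 ->
  dtau (fun t => xi t + s *: dxi t) t = dtau xi t + s *: dtau dxi t.
Proof.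
move=> /dtau_derivable[h _ _] /dtau_derivable[h' _ _].
have := is_deriveD h (is_deriveZ s h').
by move=> [_ E]; rewrite {1}/dtau derive1E -E.
Qed.

Lemma W1inf_bounded (xi : R -> R * R) : W1inf xi ->
  exists K, forall t, I01 t -> enorm (xi t) <= K.
Proof.
move=> /bdm_W1inf[[_ [K1 H1]] [_ [K2 H2]]].
exists (K1 + K2) => t It; apply: le_trans (enorm_le_sum _) _.
by apply: lerD; [exact: H1|exact: H2].
Qed.

Lemma W1inf_continuous (xi : R -> R * R) t : W1inf xi -> I01 t ->
  {for t, continuous xi}.
Proof.
move=> /W1inf_lip[K [l1 l2]] It.
rewrite (_ : xi = (fun t => ((xi t).1, (xi t).2))); last first.
  by apply/funext => s; rewrite -surjective_pairing.
by apply: (cvg_pair (G := nbhs _) (H := nbhs _)); [exact: (lip01_continuous l1)|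
  exact: (lip01_continuous l2)].
Qed.

Lemma measurable_comp_curve (g : R * R -> R * R) (xi : R -> R * R) :
  continuous g -> W1inf xi ->
  measurable_fun (@I01 R) (fun t => (g (xi t)).1) /\
  measurable_fun (@I01 R) (fun t => (g (xi t)).2).
Proof.
move=> cg W; split; apply: open_continuous_measurable_fun; try exact: itv_open.
- move=> t; rewrite inE => It.
  apply: (continuous_comp (f := fun t => g (xi t)) (g := fst)); last exact: cvg_fst.
  by apply: continuous_comp; [exact: W1inf_continuous|exact: cg].
- move=> t; rewrite inE => It.
  apply: (continuous_comp (f := fun t => g (xi t)) (g := snd)); last exact: cvg_snd.
  by apply: continuous_comp; [exact: W1inf_continuous|exact: cg].
Qed.

Lemma measurable_invr (D : set R) (f : R -> R) : measurable D ->
  measurable_fun D f -> measurable_fun D (fun t => (f t)^-1).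
Proof.
move=> mD mf.
have mV : measurable_fun [set: R] (@GRing.inv R).
  rewrite (_ : [set: R] = [set 0] `|` [set x : R | x != 0]); last first.
    by apply/esym/seteqP; split=> // x _ /=; case: (eqVneq x 0); [left|right].
  have oN : open [set x : R | x != 0].
    rewrite (_ : [set x | _] = ~` [set 0]); last first.
      by apply/seteqP; split => x /= /eqP.
    exact/closed_openC/closed_eq.
  apply/measurable_funU => //; first exact: open_measurable.
  split.
    apply: (@eq_measurable_fun _ _ _ _ _ (cst (0 : R))); last exact: measurable_cst.
    by move=> x; rewrite inE => /= ->; rewrite invr0.
  apply: open_continuous_measurable_fun => // x; rewrite inE/= => x0.
  exact: inv_continuous.
exact: measurableT_comp mV mf.
Qed.

Lemma integrable_bounded (B : set R) (g : R -> R) (K : R) : measurable B ->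
  B `<=` @I01 R -> measurable_fun B g -> (forall t, B t -> `|g t| <= K) ->
  (@leb R).-integrable B (EFin \o g).
Proof.
move=> mB BI mg gK; apply: measurable_bounded_integrable => //.
- apply: (@le_lt_trans _ _ (@leb R (@I01 R))); last by rewrite leb_I01 ltry.
  by apply: le_measure; rewrite ?inE//; exact: measurable_I01.
- exists K; split; first exact: num_real.
  by move=> x Kx t It /=; apply: le_trans (gK t It) (ltW Kx).
Qed.

Lemma enormZ (k : R) (p : R * R) : enorm (k *: p) = `|k| * enorm p.
Proof.
by rewrite /enorm dotZl dotZr mulrA -expr2 sqrtrM ?sqr_ge0// sqrtr_sqr.
Qed.

(** Keeps the velocity of a varied curve away from zero for small [s], so that [F1] and [F2] remain
    its derivatives there. *)
Lemma enorm_line_ge (P Q : R * R) (m K s : R) : 0 < m -> m <= enorm P -> enorm Q <= K ->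
  `|s| < m / (2 * (`|K| + 1)) -> (m / 2) ^+ 2 <= dot (P + s *: Q) (P + s *: Q).
Proof.
move=> m0 mP QK sm.
have K1 : 0 < 2 * (`|K| + 1) by have := normr_ge0 K; lra.
have := enormD (P + s *: Q) (- s *: Q).
rewrite -addrA -scalerDl subrr scale0r addr0 => tri.
have eZ : enorm (- s *: Q) <= m / 2.
  rewrite enormZ normrN.
  move: sm; rewrite ltr_pdivlMr// => sm.
  have QK1 : enorm Q <= `|K| + 1 by have := ler_norm K; lra.
  have := ler_wpM2l (normr_ge0 s) QK1; lra.
rewrite -enorm_sqr ler_pXn2r ?nnegrE ?enorm_ge0//; lra.
Qed.

End curve_tools.

Section second_derivative_of_T.
Variables (R : realType) (vbar : R) (w : R * R -> R * R).
Hypothesis w3 : C3 w.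
Hypothesis wv : forall x, enorm (w x) < vbar.
Hypothesis vbar0 : 0 < vbar.
Notation mu := (@lebesgue_measure R).
Notation RI g := (Rintegral (@leb R) (@I01 R) g).

Lemma measurable_F (B : set R) (x p y q : R -> R * R) :
  measurable B -> B `<=` @I01 R -> W1inf x ->
  let m2 (u : R -> R * R) := measurable_fun B (fun t => (u t).1) /\
    measurable_fun B (fun t => (u t).2) in
  m2 p -> m2 y -> m2 q ->
  measurable_fun B (fun t => fspeed vbar w (x t) (p t)) /\
  ((forall t, B t -> 0 < dot (p t) (p t)) ->
   measurable_fun B (fun t => F1 vbar w (x t) (p t) (y t) (q t)) /\
   measurable_fun B (fun t => F2 vbar w (x t) (p t) (y t) (q t))).
Proof.
move=> mB BI W m2 mp my mq.
pose A (f : R -> R) := measurable_fun B f.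
have AC k : A (fun=> k) by exact: measurable_cst.
have AD f g : A f -> A g -> A (fun z => f z + g z) by exact: measurable_funD.
have AN f : A f -> A (fun z => - f z) by move=> mf; apply: measurableT_comp mf.
have AM f g : A f -> A g -> A (fun z => f z * g z) by exact: measurable_funM.
have AS f : A f -> A (fun z => Num.sqrt (f z)).
  move=> mf; apply: measurableT_comp mf; apply: continuous_measurable_fun.
  exact: sqrt_continuous.
have AV f : A f -> (forall z, B z -> f z != 0) -> A (fun z => (f z)^-1).
  by move=> mf _; exact: measurable_invr.
have comp g : continuous g -> m2 (fun t => g (x t)).
  move=> cg; have [h1 h2] := measurable_comp_curve cg W.
  by split; [apply: measurable_funS h1 => //; exact: measurable_I01|
    apply: measurable_funS h2 => //; exact: measurable_I01].
have [cw H] := w3.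
have Aw := comp w cw.
have AD1 u := comp (fun y => D1 w y u) (H u 0 0).2.1.
have AD2 u v := comp (fun y => D2 w y u v) (H u v 0).2.2.2.1.
split; first exact: (@closure_fspeed R vbar w wv vbar0 R B A AC AD AN AM AS AV x p).
move=> p0; split.
- exact: (@closure_F1 R vbar w wv vbar0 R B A AC AD AN AM AS AV x p y q).
- exact: (@closure_F2 R vbar w wv vbar0 R B A AC AD AN AM AS AV x p y q).
Qed.

(** No lower bound on [p] is asked: unlike its derivatives, [fspeed] is continuous at zero velocity
    too, its only denominator being [fb]. *)
Lemma fspeed_bounded M : exists C, forall x p, enorm x <= M -> enorm p <= M ->
  `|fspeed vbar w x p| <= C.
Proof.
have c (z : (R * R) * (R * R)) : {for z, continuous (fun z => fspeed vbar w z.1 z.2)}.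
  pose A (f : (R * R) * (R * R) -> R) := f z' @[z' --> z] --> f z.
  have AC k : A (fun=> k) by exact: cvg_cst.
  have AD f g : A f -> A g -> A (fun z => f z + g z) by exact: cvgD.
  have AN f : A f -> A (fun z => - f z) by exact: cvgN.
  have AM f g : A f -> A g -> A (fun z => f z * g z) by exact: cvgM.
  have AS f : A f -> A (fun z => Num.sqrt (f z)).
    by move=> fA; apply: (cvg_comp f Num.sqrt fA); exact: sqrt_continuous.
  have AV f : A f -> (forall z', [set z] z' -> f z' != 0) -> A (fun z => (f z)^-1).
    by move=> fA /(_ z erefl) fz; exact: cvgV.
  have A2 (u : (R * R) * (R * R) -> R * R) : u z' @[z' --> z] --> u z ->
      A (fun z => (u z).1) /\ A (fun z => (u z).2).
    by move=> cu; split; [apply: (cvg_comp u fst cu); exact: cvg_fst|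
      apply: (cvg_comp u snd cu); exact: cvg_snd].
  have c1 : z'.1 @[z' --> z] --> z.1 by exact: cvg_fst.
  have c2 : z'.2 @[z' --> z] --> z.2 by exact: cvg_snd.
  have [cw _] := w3.
  have Aw := A2 _ (cvg_comp _ w c1 (cw _)).
  exact: (@closure_fspeed R vbar w wv vbar0 _ [set z] A AC AD AN AM AS AV
    (fun z => z.1) (fun z => z.2) Aw (A2 _ c2)).
have [C H] := compact_continuous_bounded
  (compact_setX (@compact_box R M) (@compact_box R M)) (fun z _ => c z).
by exists C => x p hx hp; apply: (H (x, p)); split; exact: enorm_box.
Qed.

Lemma fspeed_curve_bdm (x p : R -> R * R) : W1inf x ->
  bdm (fun t => (p t).1) -> bdm (fun t => (p t).2) ->
  bdm (fun t => fspeed vbar w (x t) (p t)).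
Proof.
move=> W b1 b2; split.
  have [h _] := @measurable_F (@I01 R) x p p p (@measurable_I01 R) (@subset_refl _ _) W
    (conj b1.1 b2.1) (conj b1.1 b2.1) (conj b1.1 b2.1).
  exact: h.
have [K HK] := W1inf_bounded W.
have [_ [K1 H1]] := b1; have [_ [K2 H2]] := b2.
have [C HC] := fspeed_bounded (Num.max K (K1 + K2)).
exists C => t It; apply: HC; rewrite le_max; first by rewrite HK.
apply/orP; right; apply: le_trans (enorm_le_sum _) _.
by apply: lerD; [exact: H1|exact: H2].
Qed.

(** Differentiation under the integral sign, twice. A separate [G] is exhibited because the values
    of [F2] on the exceptional null set are not controlled. *)
Lemma T2E (xi dxi : R -> R * R) (m : R) : W1inf xi -> W1inf dxi -> 0 < m ->
  {ae mu, forall t, I01 t -> m <= enorm (dtau xi t)} ->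
  exists G, [/\ bdm G, T2 vbar w xi dxi = RI G &
    {ae mu, forall t, I01 t -> G t = F2 vbar w (xi t) (dtau xi t) (dxi t) (dtau dxi t)}].
Proof.
move=> W dW m0 mae.
have aeall : {ae mu, forall t, I01 t ->
    [/\ derivable xi t 1, derivable dxi t 1 & m <= enorm (dtau xi t)]}.
  apply: aeS (aeI mae (aeI (ae_derivable_W1inf W) (ae_derivable_W1inf dW))).
  by move=> t [h1 [h2 h3]] It; split; [exact: h2|exact: h3|exact: h1].
have [N [mN N0 HN]] := ae_null aeall.
(* The theorem on differentiation under the integral sign wants its hypotheses at every point of the
   domain. *)
pose B := @I01 R `\` N.
have mI := @measurable_I01 R.
have mB : measurable B by exact: measurableD.
have BI : B `<=` @I01 R by move=> t [].
have [Kx HKx] := W1inf_bounded W; have [Ky HKy] := W1inf_bounded dW.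
have [Kp HKp] := dtau_bounded W; have [Kq HKq] := dtau_bounded dW.
pose M := `|Kx| + `|Ky| + `|Kp| + `|Kq|.
(* The bound 1 keeps the varied curves in a fixed ball; the other bound keeps their velocity at
   least [m / 2]. *)
pose rho := Num.min 1 (m / (2 * (`|Kq| + 1))).
have K1 : 0 < 2 * (`|Kq| + 1) by have := normr_ge0 Kq; lra.
have rho0 : 0 < rho by rewrite lt_min ltr01 divr_gt0.
pose P t := dtau xi t; pose Q t := dtau dxi t.
have [bP1 bP2] := bdm_dtau W; have [bQ1 bQ2] := bdm_dtau dW.
have [by1 by2] := bdm_W1inf dW.
have m2pos : 0 < (m / 2) ^+ 2 by rewrite exprn_gt0// divr_gt0.
have srho s : `]- rho, rho[%classic s -> `|s| < rho.
  by rewrite /= in_itv/= ltr_norml.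
have dotge s t : `]- rho, rho[%classic s -> B t ->
    (m / 2) ^+ 2 <= dot (P t + s *: Q t) (P t + s *: Q t).
  move=> /srho hs Bt; have [_ _ mt] := HN t Bt.
  apply: (enorm_line_ge m0 mt (HKq t (BI t Bt))).
  by move: hs; rewrite lt_min => /andP[].
have dotgt s t : `]- rho, rho[%classic s -> B t ->
    0 < dot (P t + s *: Q t) (P t + s *: Q t).
  by move=> hs Bt; apply: lt_le_trans m2pos _; exact: dotge.
have lin (u v : R * R) a b s : `]- rho, rho[%classic s -> enorm u <= a -> enorm v <= b ->
    enorm (u + s *: v) <= `|a| + `|b|.
  move=> /srho hs ua vb.
  have s1 : `|s| <= 1 by apply: ltW; move: hs; rewrite lt_min => /andP[].
  apply: le_trans (enormD _ _) _; rewrite enormZ.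
  have := ler_wpM2r (enorm_ge0 v) s1; rewrite mul1r.
  by have := ler_norm a; have := ler_norm b; lra.
have [C HC] := F12_bounded w3 wv vbar0 M m2pos.
have nn := (normr_ge0 Kx, normr_ge0 Ky, normr_ge0 Kp, normr_ge0 Kq).
have HC' s t : `]- rho, rho[%classic s -> B t ->
    `|F1 vbar w (xi t + s *: dxi t) (P t + s *: Q t) (dxi t) (Q t)| <= C /\
    `|F2 vbar w (xi t + s *: dxi t) (P t + s *: Q t) (dxi t) (Q t)| <= C.
  move=> hs Bt; have It := BI t Bt; have [[[n1 n2] n3] n4] := nn.
  apply: HC; last exact: dotge.
  - have := lin _ _ _ _ _ hs (HKx t It) (HKy t It); rewrite /M; lra.
  - have := lin _ _ _ _ _ hs (HKp t It) (HKq t It); rewrite /M /P /Q; lra.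
  - have := HKy t It; have := ler_norm Ky; rewrite /M; lra.
  - have := HKq t It; have := ler_norm Kq; rewrite /M /Q; lra.
have mPQ s : measurable_fun B (fun t => (P t + s *: Q t).1) /\
    measurable_fun B (fun t => (P t + s *: Q t).2).
  split; apply: (measurable_funS mI BI).
    exact: (bdmD bP1 (bdmZ s bQ1)).1.
  exact: (bdmD bP2 (bdmZ s bQ2)).1.
have my : measurable_fun B (fun t => (dxi t).1) /\ measurable_fun B (fun t => (dxi t).2).
  by split; apply: (measurable_funS mI BI); [exact: by1.1|exact: by2.1].
have mq : measurable_fun B (fun t => (Q t).1) /\ measurable_fun B (fun t => (Q t).2).
  by split; apply: (measurable_funS mI BI); [exact: bQ1.1|exact: bQ2.1].
have mF s := measurable_F mB BI (W1inf_comb s W dW) (mPQ s) my mq.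
pose f0 s t := fspeed vbar w (xi t + s *: dxi t) (P t + s *: Q t).
pose f1 s t := F1 vbar w (xi t + s *: dxi t) (P t + s *: Q t) (dxi t) (Q t).
pose f2 s t := F2 vbar w (xi t + s *: dxi t) (P t + s *: Q t) (dxi t) (Q t).
have int0 s : (@leb R).-integrable B (EFin \o f0 s).
  have b0 : bdm (f0 s).
    apply: fspeed_curve_bdm; first exact: W1inf_comb.
      exact: (bdmD bP1 (bdmZ s bQ1)).
    exact: (bdmD bP2 (bdmZ s bQ2)).
  have [_ [K HK]] := b0.
  apply: (integrable_bounded (K := K)) => //; first exact: (mF s).1.
  by move=> t /BI It; exact: HK.
have int1 s : `]- rho, rho[%classic s -> (@leb R).-integrable B (EFin \o f1 s).
  move=> hs; apply: (integrable_bounded (K := C)) => //.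
    exact: ((mF s).2 (fun t => dotgt s t hs)).1.
  by move=> t Bt; exact: (HC' s t hs Bt).1.
have d0 s t : `]- rho, rho[%classic s -> B t -> is_derive s 1 (f0 ^~ t) (f1 s t).
  by move=> hs Bt; apply: fspeed_line => //; exact: dotgt.
have d1 s t : `]- rho, rho[%classic s -> B t -> is_derive s 1 (f1 ^~ t) (f2 s t).
  by move=> hs Bt; apply: F1_line => //; exact: dotgt.
have intC : (@leb R).-integrable B (EFin \o (fun=> `|C|)).
  by apply: (integrable_bounded (K := `|C|)) => // t _; rewrite normr_id.
(* The velocity of the varied curve is [P t + s *: Q t] only where both curves are differentiable,
   that is on [B]. *)
have TE s : Ttime vbar w (fun t => xi t + s *: dxi t) = Rintegral (@leb R) B (f0 s).
  have Ws := W1inf_comb s W dW; have [b1 b2] := bdm_dtau Ws.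
  rewrite /Ttime (RI_ae (fspeed_curve_bdm Ws b1 b2) mN N0).
  apply: eq_Rintegral => t; rewrite inE => Bt; have [h1 h2 _] := HN t Bt.
  by rewrite dtau_comb.
have D1 s : `]- rho, rho[%classic s ->
    derive1 (fun s => Rintegral (@leb R) B (f0 s)) s = Rintegral (@leb R) B (f1 s).
  move=> hs.
  have E (s' t : R) : `]- rho, rho[%classic s' -> B t -> partial1of2 f0 s' t = f1 s' t.
    by move=> hs' Bt; rewrite partial1of2E; have [_ ->] := d0 s' t hs' Bt.
  have := @differentiation_under_integral R _ _ (@lebesgue_measure R) f0 B mB s (- rho) rho hs
    (fun s _ => int0 s) (fun s t hs Bt => @ex_derive _ _ _ _ _ _ _ (d0 s t hs Bt))
    (fun=> `|C|) (fun=> normr_ge0 C) intC.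
  move=> ->.
    by apply: eq_Rintegral => t; rewrite inE => Bt; exact: E.
  by move=> s' t hs' Bt; rewrite E//; apply: le_trans (ler_norm C); exact: (HC' s' t hs' Bt).1.
have z0 : `]- rho, rho[%classic (0 : R) by rewrite /= in_itv/= oppr_lt0 rho0.
have D2 : derive1 (fun s => Rintegral (@leb R) B (f1 s)) 0 = Rintegral (@leb R) B (f2 0).
  have E (s' t : R) : `]- rho, rho[%classic s' -> B t -> partial1of2 f1 s' t = f2 s' t.
    by move=> hs' Bt; rewrite partial1of2E; have [_ ->] := d1 s' t hs' Bt.
  have := @differentiation_under_integral R _ _ (@lebesgue_measure R) f1 B mB 0 (- rho) rho z0
    int1 (fun s t hs Bt => @ex_derive _ _ _ _ _ _ _ (d1 s t hs Bt))
    (fun=> `|C|) (fun=> normr_ge0 C) intC.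
  move=> ->.
    by apply: eq_Rintegral => t; rewrite inE => Bt; exact: E.
  by move=> s' t hs' Bt; rewrite E//; apply: le_trans (ler_norm C); exact: (HC' s' t hs' Bt).2.
pose G := (f2 0) \_ B.
exists G; split.
- split.
    apply: measurable_funTS; apply: (measurable_restrictT _ mB).1.
    exact: ((mF 0).2 (fun t => dotgt 0 t z0)).2.
  exists `|C| => t It; rewrite /G patchE; case: ifPn => [|_]; last by rewrite normr0.
  by rewrite inE => Bt; apply: le_trans (ler_norm C); exact: (HC' 0 t z0 Bt).2.
- rewrite /G -Rintegral_mkcondr (setIidr BI) -D2 /T2 /derive1n/=.
  rewrite (_ : (fun s => Ttime _ _ _) = (fun s => Rintegral (@leb R) B (f0 s))); last first.
    by apply/funext => s; exact: TE.
  (* The formula for the first derivative holds on a neighbourhood of 0, so it may be differentiated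
     again. *)
  rewrite !derive1E; apply: near_eq_derive.
  have := @itv_open _ R (- rho) rho; rewrite openE => /(_ 0 z0).
  by rewrite /interior/=; apply: filterS => s hs; exact: D1.
- exists N; split; [exact: mN|exact: N0|] => t /= nt.
  have [//|nN] := pselect (N t); exfalso; apply: nt => It.
  by rewrite /G patchE mem_set// /f2 !scale0r !addr0.
Qed.

End second_derivative_of_T.

(** * Norms and correction of the constraint *)

Section Linf_norms.
Variable R : realType.

Lemma LinfOn_ge0 d (T : measurableType d) (mu : {measure set T -> \bar R}) D g :
  (0 <= LinfOn mu D g)%E.
Proof.
by apply: le_ereal_inf_tmp => _ [C [C0 _] <-]; rewrite lee_fin.
Qed.

Lemma LinfOn_le_ge0 d (T : measurableType d) (mu : {measure set T -> \bar R}) D g (c : R) :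
  (LinfOn mu D g <= c%:E)%E -> 0 <= c.
Proof. by move=> h; rewrite -lee_fin; apply: le_trans h; exact: LinfOn_ge0. Qed.

(** The slack between [r] and [r'] yields an actual essential bound without showing that the infimum
    is attained; this is the origin of the factor 2 in [Yinf_le]. *)
Lemma LinfOn_ae (g : R -> R) (r r' : R) : r < r' ->
  (LinfOn (@lebesgue_measure R) (@I01 R) g <= r%:E)%E ->
  {ae @lebesgue_measure R, forall t, I01 t -> g t <= r'}.
Proof.
move=> rr' h.
have /ereal_inf_lt[_ [C [C0 HC] <-]] : (LinfOn (@lebesgue_measure R) (@I01 R) g < r'%:E)%E.
  by apply: le_lt_trans h _; rewrite lte_fin.
rewrite lte_fin => Cr; apply: aeS HC => t + It => /(_ It) le.
exact: (le_trans le (ltW Cr)).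
Qed.

Lemma Yinf_le (L : R) (xi : R -> R * R) (lam : R -> R) (r : R) :
  (Yinf L xi lam <= r%:E)%E -> 0 < r ->
  [/\ `|L| <= r,
     {ae @lebesgue_measure R, forall t, I01 t -> enorm (xi t) <= 2 * r},
     {ae @lebesgue_measure R, forall t, I01 t -> enorm (dtau xi t) <= 2 * r} &
     {ae @lebesgue_measure R, forall t, I01 t -> `|lam t| <= 2 * r}].
Proof.
move=> + r0; have rr : r < 2 * r by lra.
rewrite /Yinf /Zinf /LinfV /Linf.
have a0 : (0 <= `|L|%:E)%E by rewrite lee_fin.
have b0 := LinfOn_ge0 (@lebesgue_measure R) (@I01 R) (fun t => enorm (xi t)).
have c0 := LinfOn_ge0 (@lebesgue_measure R) (@I01 R) (fun t => enorm (dtau xi t)).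
have d0 := LinfOn_ge0 (@lebesgue_measure R) (@I01 R) (fun t => `|lam t|).
rewrite /leb; set a := (X in (X + _ + _ + _)%E) in a0 *.
set b := LinfOn _ _ _ in b0 *; set c := LinfOn _ _ _ in c0 *; set d := LinfOn _ _ _ in d0 *.
move=> h.
have ab0 : (0 <= a + b)%E by exact: adde_ge0.
have abc0 : (0 <= a + b + c)%E by exact: adde_ge0.
have h1 : (a + b + c <= r%:E)%E by apply: le_trans h; exact: leeDl.
have h2 : (a + b <= r%:E)%E by apply: le_trans h1; exact: leeDl.
split.
- by rewrite -lee_fin; apply: le_trans h2; exact: leeDl.
- by apply: (LinfOn_ae rr); apply: le_trans h2; exact: leeDr.
- by apply: (LinfOn_ae rr); apply: le_trans h1; exact: leeDr.
- by apply: (LinfOn_ae rr); apply: le_trans h; exact: leeDr.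
Qed.

End Linf_norms.

Section quadratic_norms.
Variable R : realType.
Notation mu := (@lebesgue_measure R).
Notation RI g := (Rintegral (@leb R) (@I01 R) g).
Implicit Types u v : R -> R * R.

Definition n2 u : R := RI (fun t => dot (u t) (u t)).

Definition bdm2 u := bdm (fun t => (u t).1) /\ bdm (fun t => (u t).2).

Lemma bdm2_dot u v : bdm2 u -> bdm2 v -> bdm (fun t => dot (u t) (v t)).
Proof. by move=> [u1 u2] [v1 v2]; exact: bdm_dot. Qed.

Lemma n2_ge0 u : 0 <= n2 u.
Proof. by apply: RI_ge0 => t _; exact: dot_ge0. Qed.

Lemma L2VE u : L2V u = Num.sqrt (n2 u).
Proof. by rewrite /L2V /n2; congr Num.sqrt; apply: eq_RI => t _; rewrite enorm_sqr. Qed.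

Lemma L2V_ge0 u : 0 <= L2V u.
Proof. exact: sqrtr_ge0. Qed.

Lemma L2V_sqr u : L2V u ^+ 2 = n2 u.
Proof. by rewrite L2VE sqr_sqrtr// n2_ge0. Qed.

Lemma Z2_ge0 (L : R) u : 0 <= Z2 L u.
Proof. by rewrite /Z2 !addr_ge0// L2V_ge0. Qed.

Lemma le_Z2 (L : R) u :
  [/\ L ^+ 2 + n2 (dtau u) <= Z2 L u ^+ 2 & n2 u + n2 (dtau u) <= Z2 L u ^+ 2].
Proof.
rewrite /Z2 -!L2V_sqr -[L ^+ 2]real_normK ?num_real//.
have := normr_ge0 L; have := L2V_ge0 u; have := L2V_ge0 (dtau u).
move: (`|L|) (L2V u) (L2V (dtau u)) => a b c c0 b0 a0.
have := mulr_ge0 a0 b0; have := mulr_ge0 a0 c0; have := mulr_ge0 b0 c0.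
have := sqr_ge0 a; have := sqr_ge0 b; have := sqr_ge0 c.
by move=> *; split; nra.
Qed.

Lemma le_sqrt_mul (a k z : R) : 0 <= k -> 0 <= z -> a <= k ^+ 2 * z ^+ 2 ->
  Num.sqrt a <= k * z.
Proof.
move=> k0 z0 h; rewrite -[leRHS]ger0_norm ?mulr_ge0// -sqrtr_sqr.
by apply: ler_wsqrtr; rewrite exprMn.
Qed.

(** A substitute for the triangle inequality in L2, obtained from a pointwise quadratic inequality.
    The loss of 1/16 is affordable. *)
Lemma L2V_perturb u v u' : bdm2 u -> bdm2 v -> bdm2 u' ->
  {ae mu, forall t, I01 t -> u' t = u t + v t} ->
  15 / 16 * L2V u <= L2V u' + 4 * L2V v.
Proof.
move=> bu bv bu' uv.
have h : 15 / 16 * n2 u - 15 * n2 v <= n2 u'.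
  rewrite /n2 -!RIZ; [|exact: bdm2_dot..].
  rewrite -RIB; [|by apply: bdmZ; exact: bdm2_dot..].
  apply: ae_le_RI.
  - by apply: bdmB; apply: bdmZ; exact: bdm2_dot.
  - exact: bdm2_dot.
  - apply: aeS uv => t + It => /(_ It) ->.
    case: (u t) (v t) => a b [c d]; rewrite /dot/=.
    (* In each coordinate, [(a + c)^2 - 15/16 a^2 + 15 c^2] is [(a + 16 c)^2 / 16]. *)
    have := sqr_ge0 (a + 16 * c); have := sqr_ge0 (b + 16 * d); nra.
move: h; rewrite -!L2V_sqr.
have := L2V_ge0 u; have := L2V_ge0 v; have := L2V_ge0 u'.
move: (L2V u) (L2V v) (L2V u') => a b c c0 b0 a0 h.
rewrite -(@ler_pXn2r _ 2)// ?nnegrE; [|lra|lra].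
have := mulr_ge0 c0 b0; have := sqr_ge0 b; have := sqr_ge0 a; nra.
Qed.

Lemma ae_eq_RI_measurable (f g : R -> R) : measurable_fun (@I01 R) f -> bdm g ->
  {ae mu, forall t, I01 t -> f t = g t} -> RI f = RI g.
Proof.
move=> mf bg fg; rewrite /Rintegral; congr fine; apply: ae_eq_integral.
- exact: measurable_I01.
- exact/measurable_EFinP.
- by apply/measurable_EFinP; exact: bg.1.
- by apply: aeS fg => t h It; rewrite h.
Qed.

Lemma RI_mul_ge (lam k h : R -> R) (r : R) : measurable_fun (@I01 R) lam ->
  0 <= r -> {ae mu, forall t, I01 t -> `|lam t| <= r} -> bdm k -> bdm h ->
  (forall t, I01 t -> `|k t| <= h t) ->
  - (r * RI h) <= RI (fun t => lam t * k t).
Proof.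
move=> ml r0 lr bk bh kh.
(* [lam] is bounded only almost everywhere; truncation gives a bounded function with the same
   integral against [k]. *)
pose l t := Num.max (- r) (Num.min r (lam t)).
have lb t : `|l t| <= r.
  by rewrite /l ler_norml le_max lexx/= ge_max ge_min lexx; lra.
have bl : bdm l.
  split; last by exists r.
  apply: measurable_maxr; first exact: measurable_cst.
  by apply: measurable_minr => //; exact: measurable_cst.
rewrite (@ae_eq_RI_measurable (fun t => lam t * k t) (fun t => l t * k t)); first last.
- apply: aeS lr => t + It => /(_ It); rewrite ler_norml => /andP[l1 l2].
  by rewrite /l min_r// max_r.
- exact: bdmM.
- by apply: measurable_funM => //; exact: bk.1.
rewrite -mulNr -RIZ//; apply: ae_le_RI; [exact: bdmZ|exact: bdmM|].
apply: aeW => t It.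
have := ler_pM (normr_ge0 _) (normr_ge0 _) (lb t) (kh t It).
by rewrite -normrM ler_norml mulNr => /andP[].
Qed.

End quadratic_norms.

Section correction.
Variable R : realType.
Notation mu := (@lebesgue_measure R).
Notation RI g := (Rintegral (@leb R) (@I01 R) g).

(** The two quotients are the real and imaginary parts of [- (a + i b) / (D.1 + i D.2)]: this lemma
    is the modulus of that division, the next two are its real and imaginary equations. *)
Lemma rotation_sqr (a b : R) (D : R * R) : dot D D != 0 ->
  (- (a * D.1 + b * D.2) / dot D D) ^+ 2 + ((a * D.2 - b * D.1) / dot D D) ^+ 2
  = (a ^+ 2 + b ^+ 2) / dot D D.
Proof. by case: D => c d; rewrite /dot/= => n0; field. Qed.

Lemma rotation_fst (a b : R) (D : R * R) : dot D D != 0 ->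
  a + (- (a * D.1 + b * D.2) / dot D D * D.1 - (a * D.2 - b * D.1) / dot D D * D.2) = 0.
Proof. by case: D => c d; rewrite /dot/= => n0; field. Qed.

Lemma rotation_snd (a b : R) (D : R * R) : dot D D != 0 ->
  b + (- (a * D.1 + b * D.2) / dot D D * D.2 + (a * D.2 - b * D.1) / dot D D * D.1) = 0.
Proof. by case: D => c d; rewrite /dot/= => n0; field. Qed.

(* The tangential part [e / L^2 + alpha] of the corrector's derivative repairs the
   linearised constraint; its two constants, [alpha] and the normal coefficient [beta],
   are fixed by requiring the corrector to vanish at both end points. *)
Lemma constraint_correction (xO xD : R * R) (xi : R -> R * R) (L : R)
    (e : R -> R) :
  xO != xD -> inX xO xD xi -> L != 0 ->
  {ae mu, forall t, I01 t -> dot (dtau xi t) (dtau xi t) = L ^+ 2} -> bdm e ->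
  exists dL (d : R -> R * R), let E := RI (fun t => e t ^+ 2) in
  [/\ indX d,
    {ae mu, forall t, I01 t -> dot (dtau d t) (dtau xi t) = e t + dL * L},
    dL ^+ 2 <= (2 / L ^+ 2 + 2 / dot (xD - xO) (xD - xO)) * E &
    n2 (dtau d) <= (2 / L ^+ 2 + 2 / dot (xD - xO) (xD - xO)) * E].
Proof.
move=> xOD [W xi0 xi1] L0 cons be.
have [b1 b2] := bdm_dtau W; have [I1 I2] := RI_dtau W.
set D := xD - xO; set Dn := dot D D.
have Dn0 : 0 < Dn.
  rewrite lt_neqAle dot_ge0 andbT eq_sym; apply: contra_neq xOD => h.
  have : qn D 0 = 0 by rewrite /qn -/Dn h /dot/= mulr0 !addr0.
  by move=> /qn_eq0[/eqP]; rewrite subr_eq0 => /eqP.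
have {}I1 : RI (fun t => (dtau xi t).1) = D.1 by rewrite I1 xi0 xi1.
have {}I2 : RI (fun t => (dtau xi t).2) = D.2 by rewrite I2 xi0 xi1.
have L2 : 0 < L ^+ 2 by rewrite exprn_even_gt0.
pose E := RI (fun t => e t ^+ 2).
have E0 : 0 <= E by apply: RI_ge0 => t _; exact: sqr_ge0.
have be1 : bdm (fun t => e t * (dtau xi t).1) by exact: bdmM.
have be2 : bdm (fun t => e t * (dtau xi t).2) by exact: bdmM.
(* [(m1, m2)] is the end point displacement caused by the part [e / L^2] alone, which [al] and [bt]
   have to cancel. *)
pose m1 := RI (fun t => e t * (dtau xi t).1) / L ^+ 2.
pose m2 := RI (fun t => e t * (dtau xi t).2) / L ^+ 2.
(* Jensen's inequality in each coordinate; the constraint on the speed turns the sum of the squares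
   into [L^2 E]. *)
have mE : m1 ^+ 2 + m2 ^+ 2 <= E / L ^+ 2.
  have h1 := RI_sqr_le be1; have h2 := RI_sqr_le be2.
  have h : RI (fun t => e t * (dtau xi t).1) ^+ 2 + RI (fun t => e t * (dtau xi t).2) ^+ 2
      <= L ^+ 2 * E.
    apply: le_trans (lerD h1 h2) _; rewrite -RID; [|exact: bdm_sqr..].
    rewrite /E -RIZ; last exact: bdm_sqr.
    rewrite le_eqVlt; apply/orP; left; apply/eqP; apply: ae_eq_RI.
    - by apply: bdmD; exact: bdm_sqr.
    - by apply: bdmZ; exact: bdm_sqr.
    - by apply: aeS cons => t + It => /(_ It) <-; rewrite /dot; ring.
  rewrite /m1 /m2.
  set A1 := RI (fun t => e t * (dtau xi t).1) in h *.
  set A2 := RI (fun t => e t * (dtau xi t).2) in h *.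
  have -> : (A1 / L ^+ 2) ^+ 2 + (A2 / L ^+ 2) ^+ 2 = (A1 ^+ 2 + A2 ^+ 2) / L ^+ 2 / L ^+ 2.
    by field.
  by rewrite ler_pM2r ?invr_gt0// ler_pdivrMr// mulrC.
pose al := - (m1 * D.1 + m2 * D.2) / Dn.
pose bt := (m1 * D.2 - m2 * D.1) / Dn.
have abE : al ^+ 2 + bt ^+ 2 = (m1 ^+ 2 + m2 ^+ 2) / Dn.
  exact: rotation_sqr (lt0r_neq0 Dn0).
have abE2 : al ^+ 2 + bt ^+ 2 <= E / L ^+ 2 / Dn by rewrite abE ler_pM2r ?invr_gt0.
pose tg t := e t / L ^+ 2 + al.
pose g1 t := tg t * (dtau xi t).1 - bt * (dtau xi t).2.
pose g2 t := tg t * (dtau xi t).2 + bt * (dtau xi t).1.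
have btg : bdm tg.
  apply: bdmD; last exact: bdm_cst.
  by under eq_fun do rewrite mulrC; exact: bdmZ.
have bg1 : bdm g1 by apply: bdmB; [exact: bdmM|exact: bdmZ].
have bg2 : bdm g2 by apply: bdmD; [exact: bdmM|exact: bdmZ].
(* With J the rotation by a right angle, the integral of [(g1, g2)] is [m + al D + bt J D]. *)
have Ig1 : RI g1 = 0.
  rewrite (@eq_RI _ _ (fun t => (L ^+ 2)^-1 * (e t * (dtau xi t).1) +
     (al * (dtau xi t).1 - bt * (dtau xi t).2))); last first.
    by move=> t _; rewrite /g1 /tg; ring.
  rewrite RID; [|exact: bdmZ|by apply: bdmB; exact: bdmZ].
  rewrite RIB; [|exact: bdmZ..].
  rewrite !RIZ// I1 I2 [_^-1 * _]mulrC -/m1 /al /bt.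
  exact: rotation_fst (lt0r_neq0 Dn0).
have Ig2 : RI g2 = 0.
  rewrite (@eq_RI _ _ (fun t => (L ^+ 2)^-1 * (e t * (dtau xi t).2) +
     (al * (dtau xi t).2 + bt * (dtau xi t).1))); last first.
    by move=> t _; rewrite /g2 /tg; ring.
  rewrite RID; [|exact: bdmZ|by apply: bdmD; exact: bdmZ].
  rewrite RID; [|exact: bdmZ..].
  rewrite !RIZ// I1 I2 [_^-1 * _]mulrC -/m2 /al /bt.
  exact: rotation_snd (lt0r_neq0 Dn0).
have [G1 [K1 [lG1 G10 G11 dG1]]] := primitive_lip01 bg1.
have [G2 [K2 [lG2 G20 G21 dG2]]] := primitive_lip01 bg2.
pose d t := (G1 t, G2 t).
have Wd : W1inf d by exact: lip_W1inf lG1 lG2.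
have dE : {ae mu, forall t, I01 t -> dtau d t = (g1 t, g2 t)}.
  apply: aeS (aeI dG1 dG2) => t [{}dG1 {}dG2] It.
  have [_ h] := @is_derive_pair _ d t _ _ (dG1 It) (dG2 It).
  by rewrite /dtau derive1E h.
(* The tangential constant contributes [al L^2] to the linearised constraint, which must equal
   [dL L]. *)
exists (al * L), d; rewrite -/Dn -/E; split.
- by split => //; rewrite /d ?G10 ?G20 ?G11 ?G21 ?Ig1 ?Ig2.
- apply: aeS (aeI dE cons) => t [{}dE {}cons] It.
  rewrite dE// /dot/= /g1 /g2.
  have -> : (tg t * (dtau xi t).1 - bt * (dtau xi t).2) * (dtau xi t).1 +
     (tg t * (dtau xi t).2 + bt * (dtau xi t).1) * (dtau xi t).2 =
     tg t * dot (dtau xi t) (dtau xi t) by rewrite /dot; ring.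
  by rewrite cons// /tg; field.
- rewrite exprMn.
  have h : al ^+ 2 <= E / L ^+ 2 / Dn by apply: le_trans abE2; rewrite lerDl sqr_ge0.
  have := ler_wpM2r (ltW L2) h.
  have -> : E / L ^+ 2 / Dn * L ^+ 2 = E / Dn by field; rewrite L0 lt0r_neq0.
  have := divr_ge0 E0 (ltW L2); have := divr_ge0 E0 (ltW Dn0); nra.
- have [bd1 bd2] := bdm_dtau Wd.
  apply: (@le_trans _ _ (RI (fun t => 2 / L ^+ 2 * e t ^+ 2 + 2 * L ^+ 2 * (al ^+ 2 + bt ^+ 2)))).
    apply: ae_le_RI.
    + exact: bdm_dot.
    + by apply: bdmD; [apply: bdmZ; exact: bdm_sqr|exact: bdm_cst].
    + apply: aeS (aeI dE cons) => t [{}dE {}cons] It.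
      rewrite dE// {1}/dot/= /g1 /g2.
      have -> : (tg t * (dtau xi t).1 - bt * (dtau xi t).2) *
        (tg t * (dtau xi t).1 - bt * (dtau xi t).2) +
        (tg t * (dtau xi t).2 + bt * (dtau xi t).1) *
        (tg t * (dtau xi t).2 + bt * (dtau xi t).1) =
        (tg t ^+ 2 + bt ^+ 2) * dot (dtau xi t) (dtau xi t) by rewrite /dot; ring.
      rewrite cons//.
      have -> : 2 / L ^+ 2 * e t ^+ 2 = 2 * (e t / L ^+ 2) ^+ 2 * L ^+ 2 by field.
      rewrite /tg; move: (e t / L ^+ 2) => r.
      have k : (r + al) ^+ 2 + bt ^+ 2 <= 2 * r ^+ 2 + 2 * (al ^+ 2 + bt ^+ 2).
        by have := sqr_ge0 (r - al); have := sqr_ge0 bt; nra.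
      by have := ler_wpM2r (ltW L2) k; lra.
  rewrite RID; [|by apply: bdmZ; exact: bdm_sqr|exact: bdm_cst].
  rewrite (RIZ _ (bdm_sqr be)) RI_cst -/E [leRHS]mulrDl lerD2l.
  have L22 : 0 <= 2 * L ^+ 2 by lra.
  have := ler_wpM2l L22 abE2.
  by have -> : 2 * L ^+ 2 * (E / L ^+ 2 / Dn) = 2 / Dn * E by field; rewrite L0 lt0r_neq0.
Qed.

End correction.

(** * The constant [Gamma_bar] as a function of the radius *)

Section Gamma.
Variable R : realType.

(** The radius occurs on both sides of the condition [Rr < B / (2 Gamma_bar Rr)]; an upper bound
    uniform in [r] separates them. Positivity comes from the term with 18 and makes the quotient
    meaningful. *)
Lemma Gamma_bar_bounded (vbar c0 c1 c2 c3 Lt : R) :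
  0 <= c0 -> c0 < vbar -> 0 <= c1 -> 0 <= c2 -> 0 <= c3 -> 0 < Lt ->
  exists2 C, 0 < C & forall r, 0 < r -> r < Lt / 2 ->
    0 < Gamma_bar vbar c0 c1 c2 c3 Lt r <= C.
Proof.
move=> c00 c0v c10 c20 c30 Lt0.
rewrite /Gamma_bar; set uv := Num.sqrt _.
have uv0 : 0 < uv.
  rewrite sqrtr_gt0 subr_gt0 ltr_pXn2r// nnegrE; lra.
have g0 : 0 <= 2 / uv ^+ 4 * (37 * c1 ^+ 3 + 21 * c1 * c2 * uv + 2 * c3 * uv ^+ 2).
  rewrite mulr_ge0 ?divr_ge0 ?exprn_ge0 ?addr_ge0 ?mulr_ge0 ?exprn_ge0 ?mulr_ge0// ?ltW//.
have g1 : 0 <= (29 * c1 ^+ 2 + 7 * uv * c2) / uv ^+ 3.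
  by rewrite divr_ge0 ?exprn_ge0 ?addr_ge0 ?mulr_ge0 ?exprn_ge0 ?mulr_ge0// ?ltW.
have g2 : 0 <= (57 * c1 ^+ 2 + 13 * uv * c2) / uv ^+ 3.
  by rewrite divr_ge0 ?exprn_ge0 ?addr_ge0 ?mulr_ge0 ?exprn_ge0 ?mulr_ge0// ?ltW.
have g3 : 0 <= 40 * c1 / uv ^+ 2 by rewrite divr_ge0 ?exprn_ge0 ?mulr_ge0// ltW.
have g4 : 0 <= 20 * c1 / uv ^+ 2 by rewrite divr_ge0 ?exprn_ge0 ?mulr_ge0// ltW.
have g5 : 0 < 18 / uv by rewrite divr_gt0.
move: g0 g1 g2 g3 g4 g5.
set G0 := 2 / uv ^+ 4 * _; set G1 := _ / uv ^+ 3; set G2 := _ / uv ^+ 3.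
set G3 := 40 * _ / _; set G4 := 20 * _ / _; set G5 := 18 / uv => g0 g1 g2 g3 g4 g5.
have V : 0 <= (vbar + c0) / (vbar - c0) by rewrite divr_ge0; lra.
move: ((vbar + c0) / (vbar - c0)) V => V V0.
pose h := Lt / 2; have h0 : 0 < h by rewrite /h; lra.
pose i := h^-1; have i0 : 0 < i by rewrite invr_gt0.
have k1 : 0 <= (V * Lt + Lt) * G0 by rewrite mulr_ge0// addr_ge0 ?mulr_ge0// ltW.
have k2 : 0 <= G4 * i by rewrite mulr_ge0// ltW.
have k3 : 0 <= G3 * i by rewrite mulr_ge0// ltW.
have k4 : 0 < G5 * i ^+ 2 by rewrite mulr_gt0// exprn_gt0.
exists ((V * Lt + Lt) * G0 + G2 + G4 * i + G1 + G3 * i + G5 * i ^+ 2); first lra.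
move=> r r0 rL.
have s0 : 0 < Lt - r by lra.
have j0 : 0 < (Lt - r)^-1 by rewrite invr_gt0.
have ji : (Lt - r)^-1 <= i by rewrite /i lef_pV2 ?posrE// /h; lra.
rewrite invfM -exprVn; move: ((Lt - r)^-1) j0 ji => j j0 ji.
have e1 : (V * Lt + r) * G0 <= (V * Lt + Lt) * G0 by apply: ler_wpM2r => //; lra.
have e2 : G4 * j <= G4 * i by exact: ler_wpM2l.
have e3 : G3 * j <= G3 * i by exact: ler_wpM2l.
have e4 : G5 * j ^+ 2 <= G5 * i ^+ 2.
  by rewrite ler_pM2l// ler_pXn2r ?nnegrE// ltW.
have e5 : 0 < G5 * j ^+ 2 by rewrite mulr_gt0// exprn_gt0.
have e6 : 0 <= G3 * j by rewrite mulr_ge0// ltW.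
apply/andP; split.
  by rewrite !lt_max; apply/orP; right; apply/orP; right; lra.
by rewrite !ge_max; apply/andP; split; apply/andP; split; lra.
Qed.

End Gamma.

(** * Perturbation of the coercivity *)

Section perturbation.
#[local] Opaque dtau.
Variable R : realType.
Notation mu := (@lebesgue_measure R).
Notation RI g := (Rintegral (@leb R) (@I01 R) g).

Lemma enorm_distC (p q : R * R) : enorm (p - q) = enorm (q - p).
Proof. by rewrite -opprB -scaleN1r enormZ normrN1 mul1r. Qed.

Lemma enorm_le_dist (p q : R * R) : enorm q <= enorm p + enorm (p - q).
Proof. by rewrite enorm_distC -{1}[q](subrKC p) enormD. Qed.

Lemma dotDl (p q u : R * R) : dot (p + q) u = dot p u + dot q u.
Proof. by rewrite /dot/=; ring. Qed.

Lemma enorm_ge_half (p q : R * R) (l r : R) : enorm q = l -> enorm (p - q) <= 2 * r ->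
  r <= l / 8 -> l / 2 <= enorm p.
Proof. by move=> <-; have := enorm_le_dist p q; have := enorm_ge0 q; lra. Qed.

Lemma qnD_le (y q y' q' : R * R) :
  qn (y + y') (q + q') <= 2 * qn y q + 2 * qn y' q'.
Proof.
case: y y' q q' => y1 y2 [y1' y2'] [q1 q2] [q1' q2']; rewrite /qn /dot/=.
have := sqr_ge0 (y1 - y1'); have := sqr_ge0 (y2 - y2').
have := sqr_ge0 (q1 - q1'); have := sqr_ge0 (q2 - q2'); nra.
Qed.

Lemma F2_increment_le (f g eps i : R) (y q y' q' : R * R) : 0 < eps ->
  `|f - g| <= eps * (qn (y + y') (q + q') + qn y' q' * i) ->
  f <= g + eps * (2 * qn y q + (2 + i) * qn y' q').
Proof.
move=> /ltW eps0 /(le_trans (ler_norm _)).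
have /(ler_wpM2l eps0) := qnD_le y q y' q'.
move: (qn _ _) (qn y q) (qn y' q') => a b c; lra.
Qed.

(** Each of the three increments costs at most 4/192 of [Z], together 1/16, which takes 15/16 down
    to 7/8. *)
Lemma Z2_increment_le (a b c a' b' c' x y z : R) : let Z := a + b + c in
  a <= a' + x -> 15 / 16 * b <= b' + 4 * y -> 15 / 16 * c <= c' + 4 * z ->
  x <= 192^-1 * Z -> y <= 192^-1 * Z -> z <= 192^-1 * Z -> 0 <= a -> 0 <= Z ->
  7 / 8 * Z <= a' + b' + c'.
Proof. by move=> /=; lra. Qed.

Lemma RI_comb (f g : R -> R) (a b c : R) : bdm f -> bdm g ->
  RI (fun t => a * (b * f t + c * g t)) = a * (b * RI f + c * RI g).
Proof.
move=> bf bg; have bf' := bdmZ b bf; have bg' := bdmZ c bg.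
by rewrite (RIZ a (bdmD bf' bg')) (RID bf' bg') (RIZ b bf) (RIZ c bg).
Qed.

Lemma increment_sum_le (eps u v z s T : R) : 0 <= eps -> u <= z ->
  v <= T * z + T * z -> s * T <= 1 -> 0 <= s -> 0 <= z ->
  eps * (2 * u + s * v) <= 4 * eps * z.
Proof.
move=> e0 uz vT sT s0 z0; rewrite (mulrC 4) -mulrA; apply: ler_wpM2l => //.
have := ler_wpM2l s0 vT; have := ler_wpM2r z0 sT; lra.
Qed.

(** In units of [B z / 64], the corrected direction gives 49, the error [h] takes at most 16 and the
    multiplier at most 4. *)
Lemma second_variation_sum (B r z z' g gs h k : R) : r <= B / 64 -> 0 < B -> 0 <= z ->
  h <= 4 * (B / 16) * z -> 49 / 64 * (B * z) <= B * z' -> B * z' <= gs -> gs <= g + h ->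
  - (2 * r * z) <= k -> B / 4 * z <= g + 2 * k.
Proof.
move=> rB B0 z0 hh h1 h2 h3 h4; have := ler_wpM2r z0 rB.
have := mulr_ge0 (ltW B0) z0; lra.
Qed.

Lemma scaled_sqr_le (B z z' : R) : 0 < B -> 0 <= z -> 7 / 8 * z <= z' ->
  49 / 64 * (B * z ^+ 2) <= B * z' ^+ 2.
Proof.
move=> B0 z0 zz'.
have -> : 49 / 64 * (B * z ^+ 2) = B * (7 / 8 * z) ^+ 2 by field.
rewrite ler_pM2l// ler_pXn2r// nnegrE; lra.
Qed.

(** A curve of zero speed cannot join distinct points. *)
Lemma feasible_neq0 (xO xD : R * R) (L : R) (xi : R -> R * R) :
  xO != xD -> feasible xO xD L xi -> L != 0.
Proof.
move=> xOD [[W xi0 xi1] cons]; apply: contra_neq xOD => L0.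
have [I1 I2] := RI_dtau W; have [b1 b2] := bdm_dtau W.
have z : {ae mu, forall t, I01 t -> dtau xi t = 0}.
  apply: aeS cons => t + It => /(_ It); rewrite L0 expr0n/= => h.
  have : qn (dtau xi t) 0 = 0 by rewrite /qn h /dot/= mulr0 !addr0.
  by move=> /qn_eq0[].
have z1 : RI (fun t => (dtau xi t).1) = 0.
  rewrite -[RHS](RI_cst (R := R)); apply: ae_eq_RI => //; first exact: bdm_cst.
  by apply: aeS z => t + It => /(_ It) ->.
have z2 : RI (fun t => (dtau xi t).2) = 0.
  rewrite -[RHS](RI_cst (R := R)); apply: ae_eq_RI => //; first exact: bdm_cst.
  by apply: aeS z => t + It => /(_ It) ->.
move: I1 I2; rewrite z1 z2 xi0 xi1 => /esym/eqP + /esym/eqP.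
rewrite !subr_eq0 => /eqP h1 /eqP h2.
by rewrite [xO]surjective_pairing [xD]surjective_pairing h1 h2.
Qed.

Lemma dtau_comb_ae (xi dxi : R -> R * R) (s : R) : W1inf xi -> W1inf dxi ->
  {ae mu, forall t, I01 t ->
    dtau (fun t => xi t + s *: dxi t) t = dtau xi t + s *: dtau dxi t}.
Proof.
move=> W dW; apply: aeS (aeI (ae_derivable_W1inf W) (ae_derivable_W1inf dW)).
by move=> t [h1 h2] It; apply: dtau_comb; [exact: h1|exact: h2].
Qed.

(** Subtracting the exact constraint at [(L', p')] leaves only terms containing [L' - L] or
    [p' - p]. *)
Lemma residual_sqr_le (a dL L L' r : R) (p p' q : R * R) :
  0 <= r -> a = dL * L - dot q p -> dot p' q = L' * dL -> `|L' - L| <= r ->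
  enorm (p' - p) <= 2 * r ->
  a ^+ 2 <= 8 * r ^+ 2 * (dL ^+ 2 + dot q q).
Proof.
move=> r0 -> c hL hp.
have E : dL * L - dot q p = - (dL * (L' - L)) + dot q (p' - p).
  have -> : dot q (p' - p) = dot p' q - dot q p by rewrite /dot/=; ring.
  by rewrite c; ring.
have h1 : (dL * (L' - L)) ^+ 2 <= dL ^+ 2 * r ^+ 2.
  rewrite exprMn ler_wpM2l ?sqr_ge0// -[(L' - L) ^+ 2]real_normK ?num_real//.
  by rewrite ler_pXn2r ?nnegrE.
have h2 : dot q (p' - p) ^+ 2 <= dot q q * (4 * r ^+ 2).
  apply: le_trans (dot_sqr_le _ _) _; rewrite ler_wpM2l ?dot_ge0// -enorm_sqr.
  have -> : 4 * r ^+ 2 = (2 * r) ^+ 2 by ring.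
  by rewrite ler_pXn2r ?nnegrE ?enorm_ge0// mulr_ge0.
rewrite E; move: h1 h2; move: (dL * (L' - L)) (dot q (p' - p)) => x y h1 h2.
have := sqr_ge0 (x + y); have := mulr_ge0 (sqr_ge0 dL) (sqr_ge0 r); nra.
Qed.

Variables (vbar : R) (w : R * R -> R * R) (xO xD : R * R).
Variables (Ls : R) (xis : R -> R * R) (B : R).
Hypotheses (vbar0 : 0 < vbar) (xOD : xO != xD) (w3 : C3 w).
Hypothesis wv : forall x, enorm (w x) < vbar.
Hypotheses (feas : feasible xO xD Ls xis) (B0 : 0 < B).
Hypothesis coercive : forall (dL : R) (dxi : R -> R * R), indX dxi ->
  {ae @leb R, forall t, I01 t -> dot (dtau dxi t) (dtau xis t) = dL * Ls} ->
  B * (Z2 dL dxi) ^+ 2 <= T2 vbar w xis dxi.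

Lemma coercive_perturbation : exists2 r0, 0 < r0 & forall r, 0 < r -> r <= r0 ->
  forall (L : R) (xi : R -> R * R) (lam : R -> R),
  inX xO xD xi -> inLinf lam ->
  (Yinf (L - Ls)%R (fun t => (xi t - xis t)%R) (fun t => (lam t - 0)%R) <= r%:E)%E ->
  forall (dL : R) (dxi : R -> R * R), indX dxi ->
    {ae @leb R, forall t, I01 t -> dot (dtau xi t) (dtau dxi t) = L * dL} ->
    B / 4 * (Z2 dL dxi) ^+ 2 <= Lzz vbar w xi lam dL dxi.
Proof.
have [Xs cons] := feas; have [Ws xis0 xis1] := Xs.
have L0 := feasible_neq0 xOD feas.
pose l := `|Ls|; have l0 : 0 < l by rewrite normr_gt0.
have ll : l ^+ 2 = Ls ^+ 2 by rewrite real_normK ?num_real.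
have l20 : 0 < l ^+ 2 by rewrite exprn_gt0.
have [Kx HKx] := W1inf_bounded Ws; have [Kp HKp] := dtau_bounded Ws.
pose eps := B / 16; have eps0 : 0 < eps by rewrite divr_gt0.
have [eta eta0 Heta] := F2_unif w3 wv vbar0 (Num.max Kx Kp) l20 eps0.
have Heta' x p y q x' p' y' q' : enorm x <= Num.max Kx Kp -> enorm p <= Num.max Kx Kp ->
    l ^+ 2 <= dot p p -> enorm (x - x') <= eta -> enorm (p - p') <= eta ->
    `|F2 vbar w x p (y + y') (q + q') - F2 vbar w x' p' y q|
      <= eps * (qn (y + y') (q + q') + qn y' q' / eta ^+ 2).
  move=> h1 h2 h3 h4 h5; have := Heta x p (y + y') (q + q') x' p' y q h1 h2 h3 h4 h5.
  by rewrite (addrC y) addrK (addrC q) addrK.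
have ieta0 : 0 < (eta ^+ 2)^-1 by rewrite invr_gt0 exprn_gt0.
pose T := Num.min (192^-1 ^+ 2) (2 + (eta ^+ 2)^-1)^-1.
have T0 : 0 < T by rewrite lt_min exprn_gt0 ?invr_gt0//= addr_gt0.
have T1 : T <= 192^-1 ^+ 2 by rewrite ge_min lexx.
have T2' : (2 + (eta ^+ 2)^-1) * T <= 1.
  have s0 : 0 < 2 + (eta ^+ 2)^-1 by rewrite addr_gt0.
  by rewrite mulrC -ler_pdivlMr// mul1r ge_min lexx orbT.
pose Cc := 2 / Ls ^+ 2 + 2 / dot (xD - xO) (xD - xO).
have Cc0 : 0 < Cc.
  have L2 : 0 < Ls ^+ 2 by rewrite -ll.
  by rewrite ltr_pwDl ?divr_gt0// divr_ge0// dot_ge0.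
(* The residual is at most [8 r^2 Z^2] in squared norm and the corrector multiplies this by [Cc]. *)
pose rho := Num.sqrt (T / (8 * Cc)).
have rho0 : 0 < rho by rewrite sqrtr_gt0 divr_gt0// mulr_gt0.
(* In order: closeness of the curves within [eta], velocity at least [l / 2] along [xi], a small
   multiplier term, a small corrector. *)
pose r0 := Num.min (Num.min (eta / 2) (l / 8)) (Num.min (B / 64) rho).
exists r0; first by rewrite !lt_min !divr_gt0// rho0.
move=> r rpos; rewrite !le_min => /andP[/andP[r_eta r_l] /andP[r_B r_rho]].
have r2eta : 2 * r <= eta by lra.
have r2 : 0 <= 2 * r by lra.
have rr : 8 * Cc * r ^+ 2 <= T.
  rewrite mulrC -ler_pdivlMr ?mulr_gt0//.
  have -> : T / (8 * Cc) = rho ^+ 2 by rewrite sqr_sqrtr// divr_ge0 ?ltW// mulr_gt0.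
  by rewrite ler_pXn2r ?nnegrE//; exact: ltW.
move=> L xi lam [W xi0 xi1] [mlam _] /Yinf_le/(_ rpos)[hL hx hp hl] dL dxi Xd con.
have [dW dxi0 dxi1] := Xd.
set Z := Z2 dL dxi; have Z0 : 0 <= Z := Z2_ge0 _ _.
have hp' : {ae mu, forall t, I01 t -> enorm (dtau xi t - dtau xis t) <= 2 * r}.
  apply: aeS (aeI hp (dtau_comb_ae (-1) W Ws)) => t [h1 h2] It.
  have := h1 It; have E : (fun t => xi t - xis t) = (fun t => xi t + (-1) *: xis t).
    by apply/funext => s; rewrite scaleN1r.
  by rewrite E h2// scaleN1r.
have ms : {ae mu, forall t, I01 t -> enorm (dtau xis t) = l}.
  apply: aeS cons => t + It => /(_ It) h.
  by rewrite /enorm h sqrtr_sqr.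
have mxi : {ae mu, forall t, I01 t -> l / 2 <= enorm (dtau xi t)}.
  apply: aeS (aeI ms hp') => t [h1 h2] It.
  exact: (enorm_ge_half (h1 It) (h2 It) r_l).
(* The amount by which the given direction violates the constraint linearised at the optimum. *)
pose e t := dL * Ls - dot (dtau dxi t) (dtau xis t).
have bds := bdm_dtau Ws; have bdd := bdm_dtau dW.
have be : bdm e := bdmB (bdm_cst _) (bdm2_dot bdd bds).
have [zL zz] := le_Z2 dL dxi; rewrite -/Z in zL zz.
have Eb : RI (fun t => e t ^+ 2) <= 8 * r ^+ 2 * Z ^+ 2.
  apply: (@le_trans _ _ (RI (fun t => 8 * r ^+ 2 * (dL ^+ 2 + dot (dtau dxi t) (dtau dxi t))))).
    apply: (ae_le_RI (bdm_sqr be) (bdmZ _ (bdmD (bdm_cst _) (bdm2_dot bdd bdd)))).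
    apply: aeS (aeI con hp') => t [h1 h2] It.
    exact: (residual_sqr_le (ltW rpos) erefl (h1 It) hL (h2 It)).
  have bq := bdm2_dot bdd bdd.
  rewrite RIZ; last by apply: bdmD => //; exact: bdm_cst.
  rewrite RID//; last exact: bdm_cst.
  by rewrite RI_cst ler_wpM2l// mulr_ge0// sqr_ge0.
have [dLc [d [Xdd dcon dLb dtb]]] := constraint_correction xOD Xs L0 cons be.
have [Wd d0 d1] := Xdd.
have CcE : Cc * RI (fun t => e t ^+ 2) <= T * Z ^+ 2.
  apply: le_trans (ler_wpM2l (ltW Cc0) Eb) _.
  have -> : Cc * (8 * r ^+ 2 * Z ^+ 2) = 8 * Cc * r ^+ 2 * Z ^+ 2 by ring.
  by rewrite ler_wpM2r ?sqr_ge0.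
have dLT : dLc ^+ 2 <= T * Z ^+ 2 by exact: le_trans dLb CcE.
have dtT : n2 (dtau d) <= T * Z ^+ 2 by exact: le_trans dtb CcE.
have dT : n2 d <= T * Z ^+ 2 by apply: le_trans dtT; exact: W1inf_poincare.
have Tz : T * Z ^+ 2 <= 192^-1 ^+ 2 * Z ^+ 2 by rewrite ler_wpM2r ?sqr_ge0.
have i192 : (0 : R) <= 192^-1 by rewrite invr_ge0.
have a1 : `|dLc| <= 192^-1 * Z.
  by rewrite -sqrtr_sqr; apply: le_sqrt_mul => //; exact: le_trans dLT Tz.
have a2 : L2V d <= 192^-1 * Z.
  by rewrite L2VE; apply: le_sqrt_mul => //; exact: le_trans dT Tz.
have a3 : L2V (dtau d) <= 192^-1 * Z.
  by rewrite L2VE; apply: le_sqrt_mul => //; exact: le_trans dtT Tz.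
pose dxi' t := dxi t + 1 *: d t.
have Wd' : W1inf dxi' := W1inf_comb 1 dW Wd.
have Xd' : indX dxi' by split => //; rewrite /dxi' ?dxi0 ?d0 ?dxi1 ?d1 scaler0 addr0.
have dE : {ae mu, forall t, I01 t -> dtau dxi' t = dtau dxi t + dtau d t}.
  by apply: aeS (dtau_comb_ae 1 dW Wd) => t + It => /(_ It) ->; rewrite scale1r.
have con' : {ae @leb R, forall t, I01 t -> dot (dtau dxi' t) (dtau xis t) = (dL + dLc) * Ls}.
  apply: aeS (aeI dE dcon) => t [h1 h2] It; rewrite h1//.
  rewrite dotDl (h2 It) /e; move: (dot _ _) => u; ring.
have bx := bdm_W1inf dW; have bd := bdm_W1inf Wd; have bd' := bdm_W1inf Wd'.
have bdt := bdm_dtau Wd; have bdt' := bdm_dtau Wd'.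
have p1 : 15 / 16 * L2V dxi <= L2V dxi' + 4 * L2V d.
  by apply: L2V_perturb => //; apply: aeW => t _; rewrite /dxi' scale1r.
have p2 : 15 / 16 * L2V (dtau dxi) <= L2V (dtau dxi') + 4 * L2V (dtau d).
  exact: (L2V_perturb bdd bdt bdt' dE).
have p0 : `|dL| <= `|dL + dLc| + `|dLc| by have := ler_normB (dL + dLc) dLc; rewrite addrK.
have Z'Z : 7 / 8 * Z <= Z2 (dL + dLc) dxi'.
  exact: (Z2_increment_le p0 p1 p2 a1 a2 a3 (normr_ge0 dL) Z0).
have Z'2 : 49 / 64 * (B * Z ^+ 2) <= B * Z2 (dL + dLc) dxi' ^+ 2.
  exact: (scaled_sqr_le B0 Z0 Z'Z).
have l20' : 0 < l / 2 by rewrite divr_gt0.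
have msl : {ae mu, forall t, I01 t -> l <= enorm (dtau xis t)}.
  by apply: aeS ms => t + It => /(_ It) ->.
(* The form at the optimum is taken in the corrected direction and the form at [xi] in the original
   one; [Heta'] absorbs both changes at once, at the cost [H]. *)
have [Gs [bGs TGs GsE]] := T2E w3 wv vbar0 Ws Wd' l0 msl.
have [G [bG TG GE]] := T2E w3 wv vbar0 W dW l20' mxi.
pose H t := eps * (2 * qn (dxi t) (dtau dxi t) + (2 + (eta ^+ 2)^-1) * qn (d t) (dtau d t)).
have bq : bdm (fun t => qn (dxi t) (dtau dxi t)) :=
  bdmD (bdm2_dot bx bx) (bdm2_dot bdd bdd).
have bqd : bdm (fun t => qn (d t) (dtau d t)) :=
  bdmD (bdm2_dot bd bd) (bdm2_dot bdt bdt).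
have bqs := bdmZ 2 bq; have bqds := bdmZ (2 + (eta ^+ 2)^-1) bqd.
have bH : bdm H := bdmZ eps (bdmD bqs bqds).
have GH : RI Gs <= RI G + RI H.
  rewrite -(RID bG bH); apply: (ae_le_RI bGs (bdmD bG bH)).
  apply: aeS (aeI (aeI GsE GE) (aeI (aeI hx hp') (aeI ms dE))).
  move=> t [[h1 h2] [[h3 h4] [h5 h6]]] It.
  have k1 : enorm (xis t) <= Num.max Kx Kp by rewrite le_max HKx.
  have k2 : enorm (dtau xis t) <= Num.max Kx Kp by rewrite le_max HKp ?orbT.
  have k3 : l ^+ 2 <= dot (dtau xis t) (dtau xis t) by rewrite -enorm_sqr h5.
  have k4 : enorm (xis t - xi t) <= eta.
    by rewrite enorm_distC; exact: le_trans (h3 It) r2eta.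
  have k5 : enorm (dtau xis t - dtau xi t) <= eta.
    by rewrite enorm_distC; exact: le_trans (h4 It) r2eta.
  have k6 : dxi' t = dxi t + d t by rewrite /dxi' scale1r.
  have E1 := h1 It; rewrite k6 (h6 It) in E1; rewrite E1 (h2 It).
  exact: (F2_increment_le eps0 (Heta' _ _ _ _ _ _ _ _ k1 k2 k3 k4 k5)).
have RIH : RI H <= 4 * eps * Z ^+ 2.
  have q1E : RI (fun t => qn (dxi t) (dtau dxi t)) = n2 dxi + n2 (dtau dxi) :=
    RID (bdm2_dot bx bx) (bdm2_dot bdd bdd).
  have q2E : RI (fun t => qn (d t) (dtau d t)) = n2 d + n2 (dtau d) :=
    RID (bdm2_dot bd bd) (bdm2_dot bdt bdt).
  have -> : RI H = eps * (2 * (n2 dxi + n2 (dtau dxi)) +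
      (2 + (eta ^+ 2)^-1) * (n2 d + n2 (dtau d))).
    by rewrite -q1E -q2E; exact: (RI_comb _ _ _ bq bqd).
  have s0 : 0 <= 2 + (eta ^+ 2)^-1 by rewrite addr_ge0// ltW.
  exact: (increment_sum_le (ltW eps0) zz (lerD dT dtT) T2' s0 (sqr_ge0 Z)).
have lamb : - (2 * r * Z ^+ 2) <=
    RI (fun t => lam t * (dot (dtau dxi t) (dtau dxi t) - dL ^+ 2)).
  have bqq := bdm2_dot bdd bdd; have bc := bdm_cst (dL ^+ 2).
  have hl' : {ae mu, forall t, I01 t -> `|lam t| <= 2 * r}.
    by apply: aeS hl => t + It => /(_ It); rewrite subr0.
  have kh t : I01 t -> `|dot (dtau dxi t) (dtau dxi t) - dL ^+ 2|
      <= dot (dtau dxi t) (dtau dxi t) + dL ^+ 2.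
    move=> _; apply: le_trans (ler_normB _ _) _.
    by rewrite !ger0_norm ?sqr_ge0 ?dot_ge0.
  apply: le_trans (RI_mul_ge mlam r2 hl' (bdmB bqq bc) (bdmD bqq bc) kh).
  rewrite lerN2; apply: (ler_wpM2l r2); rewrite (RID bqq bc) RI_cst addrC.
  exact: zL.
have TS := coercive Xd' con'; rewrite TGs in TS.
rewrite /Lzz TG.
exact: (second_variation_sum r_B B0 (sqr_ge0 Z) RIH Z'2 TS GH lamb).
Qed.

End perturbation.

(** * Choice of the radius *)

Theorem theorem11 (R : realType) (vbar : R) (xO xD : R * R)
  (w : R * R -> R * R) (Omega : set (R * R))
  (c0 c1 c2 c3 : R) (Lstar : R) (xistar : R -> R * R) (B : R) :
  0 < vbar -> xO != xD -> C3 w -> (forall x, enorm (w x) < vbar) ->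
  (* Omega: an ellipse with foci xO, xD containing every globally optimal trajectory *)
  (exists2 a : R, enorm (xD - xO) < a &
     Omega = [set x | enorm (x - xO) + enorm (x - xD) <= a]) ->
  (forall L xi, glob_opt vbar w xO xD L xi ->
     forall t, t \in `[0%R, 1%R] -> Omega (xi t)) ->
  (* bounds on w and its derivatives *)
  (LinfOn (leb2 R) Omega (fun x => enorm (w x)) <= c0%:E)%E ->
  c0 < vbar / Num.sqrt 5 ->
  (LinfOn (leb2 R) Omega (fun x => opnorm1 (D1 w x)) <= c1%:E)%E ->
  (LinfOn (leb2 R) Omega (fun x => opnorm2 (D2 w x)) <= c2%:E)%E ->
  (LinfOn (leb2 R) Omega (fun x => opnorm3 (D3 w x)) <= c3%:E)%E ->
  (* chi* = (L*, xi*, lam* = 0): globally optimal, FOC and SOSC with constant B > 0 *)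
  glob_opt vbar w xO xD Lstar xistar ->
  FOC vbar w Lstar xistar (fun _ => 0) ->
  0 < B -> SOSC vbar w Lstar xistar B ->
  let Lt := enorm (xD - xO) in
  exists Rr : R,
    [/\ 0 < Rr, Rr < B / (2 * Gamma_bar vbar c0 c1 c2 c3 Lt Rr),
        Rr < B / 40, Rr < Lt / 2 &
    forall (L : R) (xi : R -> R * R) (lam : R -> R),
      inX xO xD xi -> inLinf lam ->
      (Yinf (L - Lstar)%R (fun t => (xi t - xistar t)%R) (fun t => (lam t - 0)%R) <= Rr%:E)%E ->
      forall (dL : R) (dxi : R -> R * R), indX dxi ->
        {ae @leb R, forall t, I01 t -> dot (dtau xi t) (dtau dxi t) = L * dL} ->
        B / 4 * (Z2 dL dxi) ^+ 2 <= Lzz vbar w xi lam dL dxi].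
Proof.
move=> vbar0 xOD w3 wv _ _ h0 c0v h1 h2 h3 [feas _] _ B0 [_ coer] Lt.
have c00 : 0 <= c0 by exact: LinfOn_le_ge0 h0.
have c10 : 0 <= c1 by exact: LinfOn_le_ge0 h1.
have c20 : 0 <= c2 by exact: LinfOn_le_ge0 h2.
have c30 : 0 <= c3 by exact: LinfOn_le_ge0 h3.
have Lt0 : 0 < Lt.
  rewrite lt_neqAle enorm_ge0 andbT eq_sym; apply: contra_neq xOD => Lt0.
  have : qn (xD - xO) 0 = 0 by rewrite /qn -enorm_sqr -/Lt Lt0 expr0n /dot/= mulr0 !addr0.
  by move=> /qn_eq0[/eqP]; rewrite subr_eq0 => /eqP.
have c0v' : c0 < vbar.
  have s5 : 1 <= Num.sqrt 5 :> R by have := @ler_wsqrtr R 1 5; rewrite sqrtr1; apply; lra.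
  apply: lt_le_trans c0v _; rewrite ler_pdivrMr ?sqrtr_gt0//.
  by rewrite -[leLHS]mulr1 ler_pM2l.
have [C C0 HC] := Gamma_bar_bounded c00 c0v' c10 c20 c30 Lt0.
have [r0 r00 Hr] := coercive_perturbation vbar0 xOD w3 wv feas B0 coer.
(* The constants 80, 4 and [4 * C] are twice those in the bounds to be met, which turns weak
   inequalities into strict ones. *)
pose r := Num.min (Num.min r0 (B / 80)) (Num.min (Lt / 4) (B / (4 * C))).
have BC0 : 0 < B / (4 * C) by rewrite divr_gt0// mulr_gt0.
have rpos : 0 < r by rewrite !lt_min r00 BC0 !divr_gt0.
have : r <= r by []; rewrite {2}/r !le_min => /andP[/andP[rr0 rB] /andP[rL rC]].
have rL2 : r < Lt / 2 by lra.
have /andP[G0 GC] := HC r rpos rL2.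
exists r; split => //; [|lra|exact: Hr].
apply: le_lt_trans rC _.
rewrite ltr_pM2l// ltf_pV2 ?posrE ?mulr_gt0//; lra.
Qed.
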